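(* Let $(W,S)$ be a Coxeter group. Assume that any two different simple reflections in $S$ do not commute and that the cardinalities of the finite parabolic subgroups of $W$ have a common upper bound. Then Lusztig's $a$-function on $W$ is bounded by the length of the longest element of a certain finite parabolic subgroup of $W$; that is, there is a finite parabolic subgroup $P$ of $W$, with longest element $w_0$, such that $a(w)\le l(w_0)$ for all $w\in W$.
   Context: $l$ is the length function of $(W,S)$, $\le$ the Bruhat order. A parabolic subgroup is a subgroup generated by a subset of $S$. Hecke algebra: $H$ is the algebra over $\mathcal A=\mathbb Z[q^{1/2},q^{-1/2}]$ ($q$ an indeterminate), free with basis $T_w$ ($w\in W$), with $(T_s-q)(T_s+1)=0$ for $s\in S$ and $T_wT_u=T_{wu}$ if $l(wu)=l(w)+l(u)$. Let $P_{y,w}\in\mathbb Z[q]$ be the Kazhdan-Lusztig polynomials and $C_w=q^{-l(w)/2}\sum_{y\le w}P_{y,w}T_y$; the $C_w$ form a basis of $H$. Write $C_wC_u=\sum_{v}h_{w,u,v}C_v$ with $h_{w,u,v}\in\mathcal A$. Lusztig's $a$-function: $a(v)=\max\{i\in\mathbb N\mid i=\deg h_{w,u,v},\ w,u\in W\}$, the degree being the highest power of $q^{1/2}$ that occurs. *)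

(* Defs.v *)
From HB Require Import structures.
From Stdlib Require Import Relations.Relation_Operators.
From mathcomp Require Import all_boot all_order all_algebra.
From mathcomp Require Import ring.
From mathcomp Require Import all_classical.

Set Implicit Arguments.
Unset Strict Implicit.
Unset Printing Implicit Defensive.

Import Order.TTheory GRing.Theory Num.Theory.

Local Open Scope classical_set_scope.
Local Open Scope ring_scope.

(** * The ring of Laurent polynomials in v = q^(1/2) over the integers *)

Local Notation ratfun := {fraction {poly int}}.
Local Notation "x %:F" := (@FracField.tofrac _ x).

(* Z[v, v^-1] is the subring of the fraction field of Z[v] made of the
   fractions that become polynomials after multiplication by a power of v. *)
Definition laurent_pred : {pred ratfun} := fun x =>
  `[< exists n (p : {poly int}), x * ('X%:F) ^+ n = p%:F >].

Lemma laurent_subring : subring_closed laurent_pred.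
Proof.
split.
- by apply/asboolP; exists 0%N, 1; rewrite mul1r expr0 tofrac1.
- move=> x y /asboolP[n [p Hp]] /asboolP[m [r Hr]]; apply/asboolP.
  exists (n + m)%N, (p * 'X^m - r * 'X^n).
  by rewrite tofracB !tofracM !tofracXn -Hp -Hr exprD; ring.
- move=> x y /asboolP[n [p Hp]] /asboolP[m [r Hr]]; apply/asboolP.
  by exists (n + m)%N, (p * r); rewrite tofracM -Hp -Hr exprD mulrACA.
Qed.

HB.instance Definition _ :=
  GRing.isSubringClosed.Build ratfun laurent_pred laurent_subring.

Definition laurent := {x : ratfun | laurent_pred x}.
HB.instance Definition _ := [isSub of laurent for @sval _ _].
HB.instance Definition _ := [Choice of laurent by <:].
HB.instance Definition _ := [SubChoice_isSubComNzRing of laurent by <:].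

Lemma laurent_v_subproof : laurent_pred ('X%:F).
Proof. by apply/asboolP; exists 0%N, 'X; rewrite expr0 mulr1. Qed.

Lemma laurent_vinv_subproof : laurent_pred ('X%:F)^-1.
Proof.
apply/asboolP; exists 1%N, 1.
by rewrite expr1 mulVf ?tofrac1 // tofrac_eq0 polyX_eq0.
Qed.

Definition v_ : laurent := Sub ('X%:F) laurent_v_subproof.
Definition vinv : laurent := Sub ('X%:F)^-1 laurent_vinv_subproof.

Lemma mul_v_vinv : v_ * vinv = 1.
Proof.
by apply: val_inj; rewrite rmorphM rmorph1 /= mulfV // tofrac_eq0 polyX_eq0.
Qed.

Definition q_ : laurent := v_ ^+ 2.

Definition eval_at (p : {poly int}) (a : laurent) : laurent :=
  (map_poly intr p).[a].

(* [has_degree x d]: v^d is the highest power of v occurring in x, where x is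
   written as v^(-n) p(v) with p a nonzero polynomial. *)
Definition has_degree (x : laurent) (d : int) : Prop :=
  exists n (p : {poly int}),
    [/\ x * v_ ^+ n = eval_at p v_, p != 0 & d = (size p).-1%:Z - n%:Z].

(** * Bases of modules *)

Section Basis.
Variables (A : nzRingType) (M : lmodType A) (I : choiceType) (b : I -> M).

Definition decomposition (x : M) (c : I -> A) : Prop :=
  finite_set [set i | c i != 0] /\ x = \sum_(i \in [set: I]) c i *: b i.

Definition is_basis : Prop := forall x, exists! c, decomposition x c.

(* The value on x of the i-th coordinate function, when b is a basis. *)
Definition coordinate (x : M) (i : I) : A :=
  xget 0 [set a | exists2 c, decomposition x c & c i = a].
End Basis.

(** * Coxeter groups *)

Definition is_max (A : set nat) (n : nat) : Prop := A n /\ ubound A n.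

Section Coxeter.
Variables (W : groupType) (S : set W).

Definition subgroup (A : set W) : Prop := group_closed [in A].

Definition generated (J : set W) : set W := smallest subgroup J.

Definition has_order (G : groupType) (x : G) (m : nat) : Prop :=
  [/\ (0 < m)%N, (x ^+ m)%g = 1%g &
      forall k, (0 < k < m)%N -> (x ^+ k)%g <> 1%g].

(* S generates W, consists of elements of order 2, and the relations
   (s t)^m(s,t) = 1, for s, t in S with s t of finite order m(s,t), present W:
   every map from S to a group G respecting them extends to a homomorphism. *)
Definition coxeter_system : Prop :=
  [/\ generated S = [set: W],
      forall s, S s -> has_order s 2 &
      forall (G : groupType) (f : W -> G),
        (forall s t m, S s -> S t -> has_order (s * t)%g m ->
           ((f s * f t) ^+ m)%g = 1%g) ->
        exists2 phi : W -> G,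
          {morph phi : x y / (x * y)%g} & forall s, S s -> phi s = f s].

Definition is_word_length (w : W) : set nat :=
  [set n | exists s : seq W,
     [/\ forall x, x \in s -> S x, size s = n & (\prod_(x <- s) x)%g = w]].

Definition len (w : W) : nat :=
  xget 0%N [set n | is_word_length w n /\ lbound (is_word_length w) n].

Definition reflection (t : W) : Prop :=
  exists x s, S s /\ t = (x * s * x^-1)%g.

Definition bruhat_step (y w : W) : Prop :=
  (exists2 t, reflection t & w = (y * t)%g) /\ (len y < len w)%N.

Definition bruhat : W -> W -> Prop := clos_refl_trans W bruhat_step.

Definition parabolic (P : set W) : Prop :=
  exists2 J, J `<=` S & P = generated J.

Definition longest_element (P : set W) (w0 : W) : Prop :=
  P w0 /\ (forall x, P x -> (len x <= len w0)%N).

(** * The Hecke algebra and its Kazhdan-Lusztig basis *)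

Section Hecke.
Variables (H : algType laurent) (T : W -> H).

Definition hecke_algebra : Prop :=
  [/\ is_basis T,
      forall s, S s -> (T s - q_ *: 1) * (T s + 1) = 0 &
      forall w u, len (w * u)%g = (len w + len u)%N -> T w * T u = T (w * u)%g].

(* The bar involution: the ring endomorphism of H sending v to v^-1 and T_w to
   the inverse of T_(w^-1). *)
Definition is_bar (bar : {rmorphism H -> H}) : Prop :=
  bar (v_ *: 1) = vinv *: 1 /\
  forall w, bar (T w) * T (w^-1)%g = 1 /\ T (w^-1)%g * bar (T w) = 1.

Definition KL_element (P : W -> W -> {poly int}) (w : W) : H :=
  vinv ^+ len w *:
    \sum_(y \in [set y | bruhat y w]) eval_at (P y w) q_ *: T y.

(* The characterisation by which Kazhdan and Lusztig define P_{y,w} (y <= w),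
   the bound being deg P_{y,w} <= (l(w) - l(y) - 1) / 2 for y < w. *)
Definition KL_polynomials (P : W -> W -> {poly int}) : Prop :=
  [/\ forall w, P w w = 1,
      forall y w, bruhat y w -> y <> w ->
        (2 * (size (P y w)).-1 + len y + 1 <= len w)%N &
      exists2 bar : {rmorphism H -> H}, is_bar bar &
        forall w, bar (KL_element P w) = KL_element P w].

Variable P : W -> W -> {poly int}.
Local Notation C := (KL_element P).

Definition KL_structure_constant (w u v : W) : laurent :=
  coordinate C (C w * C u) v.

Definition lusztig_a_function (a : W -> nat) : Prop :=
  forall v, is_max
    [set i | exists w u, has_degree (KL_structure_constant w u v) i%:Z] (a v).
End Hecke.
End Coxeter.

(* Main.v *)
(* With the normalised basis tT w = v^(-l(w)) T_w, the element C_w is tT w plus a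
   combination of the tT y with coefficients in v^(-1) Z[v^(-1)]; hence it is
   enough to bound the degree in v of the products tT x * tT u. The bound is the
   largest finite order N of a product of two generators, which is the length of
   the longest element of a finite dihedral parabolic subgroup (N = 1 if all
   these orders are infinite).

   Expanding tT x * tT u letter by letter, a factor v - v^(-1) appears only when
   a letter s of u is a right descent of the current element x, and it then
   suffices that tT x * tT u has degree at most N - 1 when s is a right descent
   of x but not a left descent of u. As no two generators commute, if s and r are
   right descents of x then r is the only right descent of x s. It follows that x u
   can fail to be reduced only inside a dihedral subgroup <s, t> of finite order
   2m: x = c a and u = b u' with a, b in <s, t>, and the expansion of
   tT a * tT b contains tT y with degree at most l(y) - 1. If l(y) >= 3 then
   (c y) u' is reduced; if l(y) = 2 then tT (c y) * tT u' has degree at most 1;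
   and if l(y) = 1 induction applies. *)
Require Import Defs.
From HB Require Import structures.
From Stdlib Require Import Relations.Relation_Operators.
From mathcomp Require Import all_boot all_order all_algebra.
From mathcomp Require Import ring zify finmap.
From mathcomp Require Import all_classical.

Set Implicit Arguments.
Unset Strict Implicit.
Unset Printing Implicit Defensive.

Import Order.TTheory GRing.Theory Num.Theory.

Local Open Scope classical_set_scope.

(** * The reflection cocycle and the exchange condition *)

Section Cocycle.
Variable W : groupType.
Local Open Scope group_scope.

(* W acting by conjugation on the subsets of W, a subset being encoded by its
   indicator function with values in Z/2. *)
Definition subsets_semidirect := (W * (W -> bool))%type.
Local Notation G := subsets_semidirect.

HB.instance Definition _ := Choice.copy G (W * (W -> bool))%type.

Definition semidirect_one : G := (1, fun=> false).
Definition semidirect_inv (x : G) : G := (x.1^-1, fun t => x.2 (t ^ x.1^-1)).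
Definition semidirect_mul (x y : G) : G :=
  (x.1 * y.1, fun t => x.2 t (+) y.2 (t ^ x.1)).

Lemma semidirect_mulA : associative semidirect_mul.
Proof.
move=> x y z; congr pair; first exact: mulgA.
by apply/funext => t /=; rewrite conjgM addbA.
Qed.

Lemma semidirect_mul1 : left_id semidirect_one semidirect_mul.
Proof.
move=> [w f]; congr pair; first exact: mul1g.
by apply/funext => t /=; rewrite conjg1.
Qed.

Lemma semidirect_1mul : right_id semidirect_one semidirect_mul.
Proof.
move=> [w f]; congr pair; first exact: mulg1.
by apply/funext => t /=; rewrite addbF.
Qed.

Lemma semidirect_mulV :
  left_inverse semidirect_one semidirect_inv semidirect_mul.
Proof.
move=> [w f]; congr pair; first exact: mulVg.
by apply/funext => t /=; rewrite addbb.
Qed.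

Lemma semidirect_Vmul :
  right_inverse semidirect_one semidirect_inv semidirect_mul.
Proof.
move=> [w f]; congr pair; first exact: mulgV.
by apply/funext => t /=; rewrite conjgK addbb.
Qed.

HB.instance Definition _ := isGroup.Build G semidirect_mulA semidirect_mul1
  semidirect_1mul semidirect_mulV semidirect_Vmul.

(** Reduces a Coxeter relation in the semidirect product to a parity count. *)
Lemma semidirect_exp (x : G) n :
  x ^+ n = (x.1 ^+ n, fun t => \big[addb/false]_(i < n) x.2 (t ^ x.1 ^+ i)).
Proof.
elim: n => [|n IHn].
  by rewrite !expg0; congr pair; apply/funext => t; rewrite big_ord0.
rewrite expgSr IHn; congr pair => /=; first by rewrite expgSr.
by apply/funext => t; rewrite big_ord_recr.
Qed.

End Cocycle.

Section Coxeter.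
Variables (W : groupType) (S : set W).
Hypothesis coxeterWS : coxeter_system S.
Local Open Scope group_scope.
Implicit Types (x y z w u c : W) (p : seq W).
Local Notation l := (len S).

Let genS : generated S = [set: W]. Proof. by case: coxeterWS. Qed.

Lemma simple_neq1 s : S s -> s <> 1.
Proof.
case: coxeterWS => _ ord2 _ /ord2[_ _ /(_ 1%N isT)].
by rewrite expg1.
Qed.

Lemma simple_sq s : S s -> s * s = 1.
Proof. by case: coxeterWS => _ ord2 _ /ord2[_]; rewrite expg2. Qed.

Lemma simpleV s : S s -> s^-1 = s.
Proof. by move=> /simple_sq /mulg1_eq. Qed.

Lemma simpleK s x : S s -> x * s * s = x.
Proof. by move=> Ss; rewrite -mulgA simple_sq ?mulg1. Qed.

Lemma simpleKl s x : S s -> s * (s * x) = x.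
Proof. by move=> Ss; rewrite mulgA simple_sq ?mul1g. Qed.

(** * Words in the generators and the length function *)

Definition is_word p := forall x, x \in p -> S x.

Lemma is_word_cons s p : is_word (s :: p) <-> S s /\ is_word p.
Proof.
split=> [H|[Ss Sp] x]; last by rewrite inE => /predU1P[->|/Sp].
by split=> [|x xp]; apply: H; rewrite inE ?eqxx // xp orbT.
Qed.

Lemma is_word_cat p1 p2 : is_word (p1 ++ p2) <-> is_word p1 /\ is_word p2.
Proof.
split=> [H|[H1 H2] x]; last by rewrite mem_cat => /orP[/H1|/H2].
by split=> x xp; apply: H; rewrite mem_cat xp ?orbT.
Qed.

Lemma prod_word_inv p : is_word p ->
  (\prod_(x <- p) x)^-1 = \prod_(x <- rev p) x.
Proof.
elim: p => [|s p IHp]; first by rewrite !big_nil invg1.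
move=> /is_word_cons[Ss /IHp {}IHp].
by rewrite big_cons invgM IHp rev_cons -cats1 big_cat big_seq1 /= simpleV.
Qed.

Lemma word_exists w : exists2 p, is_word p & w = \prod_(x <- p) x.
Proof.
suff: generated S `<=` [set w | exists2 p, is_word p & w = \prod_(x <- p) x].
  by rewrite genS; exact.
apply: smallest_sub => [|s Ss]; last first.
  by exists [:: s]; rewrite ?big_seq1 // => x; rewrite inE => /eqP->.
split; first by rewrite inE; exists [::]; rewrite ?big_nil // => x.
move=> x y; rewrite !inE => -[p Sp ->] [q Sq ->].
exists (p ++ rev q); last by rewrite big_cat prod_word_inv.
by apply/is_word_cat; split => // t; rewrite mem_rev; exact: Sq.
Qed.

Lemma word_ind (Q : W -> Prop) :
  Q 1 -> (forall s w, S s -> Q w -> Q (s * w)) -> forall w, Q w.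
Proof.
move=> Q1 QS w; have [p + ->] := word_exists w.
elim: p => [|s p IHp]; first by rewrite big_nil.
by move=> /is_word_cons[Ss /IHp]; rewrite big_cons; exact: QS.
Qed.

Lemma lenP w : is_word_length S w (l w) /\ lbound (is_word_length S w) (l w).
Proof.
apply: (@xgetPex _ 0%N
  [set n | is_word_length S w n /\ lbound (is_word_length S w) n]).
have [p Sp pw] := word_exists w.
have ex_len : exists n, `[< is_word_length S w n >].
  by exists (size p); apply/asboolP; exists p.
exists (ex_minn ex_len); case: ex_minnP => n /asboolP nw n_min; split=> // k kw.
by rewrite -[(_ <= _)%O]/(n <= k)%N; apply: n_min; apply/asboolP.
Qed.

Lemma reduced_word w :
  exists p, [/\ is_word p, size p = l w & w = \prod_(x <- p) x].
Proof. by have [[p [Sp szp pw]] _] := lenP w; exists p. Qed.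

Lemma len_word p : is_word p -> l (\prod_(x <- p) x) <= size p.
Proof. by move=> Sp; have [_] := lenP (\prod_(x <- p) x); apply; exists p. Qed.

Lemma len1 : l 1 = 0%N.
Proof.
apply/eqP; rewrite -leqn0; have := @len_word [::].
by rewrite big_nil; apply=> x; rewrite in_nil.
Qed.

Lemma len_eq0 w : l w = 0%N -> w = 1.
Proof.
have [p [_ szp pw]] := reduced_word w.
by rewrite -szp pw => /size0nil->; rewrite big_nil.
Qed.

Lemma lenM x y : l (x * y) <= l x + l y.
Proof.
have [p [Sp <- ->]] := reduced_word x; have [q [Sq <- ->]] := reduced_word y.
by rewrite -big_cat -size_cat /= len_word //; apply/is_word_cat.
Qed.

Lemma lenV x : l x^-1 = l x.
Proof.
suff le_lV y : l y^-1 <= l y by apply/eqP; rewrite eqn_leq le_lV -{1}[x]invgK le_lV.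
have [p [Sp <- ->]] := reduced_word y.
by rewrite prod_word_inv // -size_rev len_word // => s; rewrite mem_rev; exact: Sp.
Qed.

Lemma len_simple s : S s -> l s = 1%N.
Proof.
move=> Ss; have: l s <= 1.
  have := @len_word [:: s]; rewrite big_seq1; apply=> x.
  by rewrite inE => /eqP->.
by case: (posnP (l s)) => [/len_eq0/(simple_neq1 Ss)//|]; case: (l s) => [|[]].
Qed.

(** The universal property, applied to the map sending [s] to the pair of [s] and the indicator of
    [s], gives a homomorphism into the semidirect product; its second component is the cocycle. For
    a reflection [t], [N w t] will mean that [t] shortens [w] from the left. *)
Lemma inversion_cocycle : exists N : W -> W -> bool,
  (forall x y t, N (x * y) t = N x t (+) N y (t ^ x)) /\
  (forall s t, S s -> N s t = (t == s)).
Proof.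
pose f (s : W) : subsets_semidirect W := (s, fun t => t == s).
have [_ _ univ] := coxeterWS.
have [|phi phiM phiS] := univ _ f.
  move=> s t m Ss St [m_gt0 stm _]; rewrite semidirect_exp /=.
  congr pair => //; apply/funext => x /=; rewrite big_split /=.
  set r := s * t.
  have s_r i : s * r ^- i = r ^+ i * s.
    have <- : (r ^+ i) ^ s = r ^- i.
      rewrite conjXg -expVgn; congr (_ ^+ _).
      by rewrite conjgE -mulgA mulKg invgM !simpleV.
    by rewrite conjgE mulVKg.
  have conj_r i y z : y ^ r ^+ i = z <-> y = r ^+ i * z * r ^- i.
    split=> [<-|->]; first by rewrite conjgE mulVKg mulgK.
    by rewrite conjgE mulgVK mulKg.
  (* The reflections r ^+ j * s, for j < 2m, repeat with period m, so that each
     of them occurs an even number of times. *)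
  pose F j := x == r ^+ j * s.
  have F_even i : (x ^ r ^+ i == s) = F (i + i)%N.
    by apply/eqP/eqP; rewrite conj_r -mulgA s_r mulgA -expgnDr.
  have F_odd i : ((x ^ r ^+ i) ^ s == t) = F (i + i).+1.
    have -> : ((x ^ r ^+ i) ^ s == t) = (x ^ r ^+ i == r * s).
      rewrite -(inj_eq (@conjg_inj _ s) _ (r * s)); congr (_ == _).
      by rewrite conjgE simpleK // mulKg.
    have -> : F (i + i).+1 = (x == r ^+ i * (r * s) * r ^- i).
      by rewrite mulgA -expgSr -mulgA s_r mulgA -expgnDr addSn.
    by apply/eqP/eqP; rewrite conj_r.
  under eq_bigr do rewrite F_even.
  under [X in _ (+) X = _]eq_bigr do rewrite F_odd.
  have F_per j : F (j + m)%N = F j by rewrite /F expgnDr stm mulg1.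
  have split_F k : \big[addb/false]_(i < k) F (i + i)%N (+)
      \big[addb/false]_(i < k) F (i + i).+1 = \big[addb/false]_(i < k + k) F i.
    elim: k => [|k IHk]; first by rewrite !big_ord0.
    rewrite addSn addnS !big_ord_recr /= -IHk /=.
    by rewrite addbACA !addbA.
  rewrite split_F big_split_ord /=.
  by under [X in _ (+) X = _]eq_bigr do rewrite addnC F_per; rewrite addbb.
(* The twist in the product is by the first component of [phi x], so the cocycle identity needs this
   component to be [x] itself. *)
have phi1 w : (phi w).1 = w.
  have phi_1 : phi 1 = 1.
    by apply: (mulgI (phi 1)); rewrite -phiM !mulg1.
  elim/word_ind: w => [|s w Ss IHw]; first by rewrite phi_1.
  by rewrite phiM phiS //= -[in RHS]IHw.
exists (fun w => (phi w).2); split=> [x y t|s t Ss]; last by rewrite phiS.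
by rewrite phiM /= phi1.
Qed.

Lemma lenVM x y : l x <= l (x * y) + l y.
Proof. by rewrite -{1}[x](mulgK y) -[l y]lenV lenM. Qed.

Lemma lenMV x y : l y <= l x + l (x * y).
Proof. by rewrite -{1}[y](mulKg x) -[l x]lenV lenM. Qed.

(** The strong exchange condition. The first letter [s] is peeled off: if [t = s] it is the deleted
    letter, otherwise the cocycle identity passes to [t ^ s] and the rest of the word. *)
Lemma len_inversion (N : W -> W -> bool) :
    (forall x y t, N (x * y) t = N x t (+) N y (t ^ x)) ->
    (forall s t, S s -> N s t = (t == s)) ->
  forall p t, is_word p -> N (\prod_(x <- p) x) t ->
  exists p1 s p2, p = p1 ++ s :: p2 /\
    t * \prod_(x <- p) x = \prod_(x <- p1) x * \prod_(x <- p2) x.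
Proof.
move=> NM NS p; elim: p => [|s p IHp] t.
  have N1 : N 1 t = false by have := NM 1 1 t; rewrite mulg1 conjg1 addbb.
  by rewrite big_nil N1.
move=> /is_word_cons[Ss Sp]; rewrite big_cons NM NS //.
have [->|_ /= /(IHp _ Sp)[p1 [s' [p2 [-> eq_p]]]]] := eqVneq t s.
  by exists [::], s, p; rewrite big_nil mul1g simpleKl.
exists (s :: p1), s', p2; split=> //; rewrite big_cons -mulgA -eq_p conjgE.
by rewrite !mulgA mulgV mul1g.
Qed.

Lemma reflectionV t : reflection S t -> t^-1 = t.
Proof. by move=> [x [s [Ss ->]]]; rewrite !invgM invgK (simpleV Ss) mulgA. Qed.

Section Inversions.
Variable N : W -> W -> bool.
Hypothesis NM : forall x y t, N (x * y) t = N x t (+) N y (t ^ x).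
Hypothesis NS : forall s t, S s -> N s t = (t == s).

Lemma inversion_len w t : N w t -> l (t * w) < l w.
Proof.
have [p [Sp <- pw]] := reduced_word w; rewrite {1}pw.
move=> /(len_inversion NM NS Sp)[p1 [s [p2 [p_eq]]]]; rewrite -pw => ->.
move: Sp; rewrite p_eq => /is_word_cat[Sp1 /is_word_cons[_ Sp2]].
by rewrite -big_cat size_cat /= addnS ltnS -size_cat len_word //; apply/is_word_cat.
Qed.

(** Expanding [N] at [t] along [x * x^-1] and along [x * s * x^-1] gives two sums that differ only
    by [N s s = true], and the first one is [false]. *)
Lemma inversion_refl t : reflection S t -> N t t.
Proof.
move=> [x [s [Ss ->]]].
have N1 y : N 1 y = false by have := NM 1 1 y; rewrite mulg1 conjg1 addbb.
have conj_x : (x * s * x^-1) ^ x = s by rewrite conjgE !mulgA mulVg mul1g mulgVK.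
have ss : s ^ s = s by rewrite conjgE mulgA mulVg mul1g.
have := NM x x^-1 (x * s * x^-1); rewrite mulgV N1 conj_x => N_x.
have := NM (x * s) x^-1 (x * s * x^-1).
rewrite (NM x s) conjgM conj_x ss (NS _ Ss) eqxx => ->; move: N_x.
by case: (N x _); case: (N _ s).
Qed.

(** For the converse: if [N w t] is false, then [N (t * w) t] is true because [N t t] is, so [w] is
    shorter than [t * w]. *)
Lemma inversionP w t : reflection S t -> N w t = (l (t * w) < l w).
Proof.
move=> refl_t; case Nwt : (N w t); first by rewrite inversion_len.
have : N (t * w) t.
  by rewrite NM inversion_refl // [t ^ t]conjgE mulgA mulVg mul1g Nwt.
move=> /inversion_len; rewrite -{1}(reflectionV refl_t) mulKg => /ltnW.
by rewrite leqNgt => /negbTE.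
Qed.

End Inversions.

(** A Bruhat step multiplies by a reflection on the right; conjugation by [w] moves it to the left,
    where strong exchange deletes a letter of the given word. *)
Lemma bruhat_subword y w : bruhat S y w -> forall p, is_word p ->
  w = \prod_(x <- p) x -> exists2 q, subseq q p & y = \prod_(x <- q) x.
Proof.
have [N [NM NS]] := inversion_cocycle.
elim=> {y w} [y w [[t [x [s [Ss t_eq]]] w_eq] lt_yw]|w|x y z _ IHxy _ IHyz].
- move=> p Sp wp; pose t' := w * t * w^-1.
  have t_refl : reflection S t by exists x, s.
  have t'w : t' * w = y.
    by rewrite /t' mulgVK w_eq -mulgA -{1}(reflectionV t_refl) mulVg mulg1.
  have t'_refl : reflection S t'.
    by exists (w * x), s; split=> //; rewrite /t' t_eq invgM !mulgA.
  have : N w t' by rewrite (inversionP NM NS) // t'w.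
  rewrite {1}wp => /(len_inversion NM NS Sp)[p1 [r [p2 [p_eq]]]].
  rewrite -wp t'w => ->; exists (p1 ++ p2); last by rewrite big_cat.
  by rewrite p_eq cat_subseq // subseq_cons.
- by move=> p Sp ->; exists p.
- move=> p Sp /(IHyz _ Sp)[q qp]; move=> yq.
  have Sq : is_word q by move=> s /(mem_subseq qp); exact: Sp.
  by have [r rq ->] := IHxy q Sq yq; exists r => //; apply: subseq_trans qp.
Qed.

(** Makes the sum defining [KL_element] a finite one: the subwords of a fixed word are indexed by
    bit masks. *)
Lemma finite_bruhat w : finite_set [set y | bruhat S y w].
Proof.
have [p Sp wp] := word_exists w.
apply: (@sub_finite_set _ _
  [set \prod_(x <- mask (val m) p) x | m in [set: (size p).-tuple bool]]).
  move=> y /bruhat_subword/(_ p Sp wp)[q /subseqP[m szm ->] ->].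
  by exists (Tuple (introT eqP szm)).
by apply: finite_image; exact: finite_finset.
Qed.

(** * Left and right descents *)

Definition rdesc x s := l (x * s) < l x.
Definition ldesc u s := l (s * u) < l u.

Lemma ldescV u s : S s -> ldesc u s = rdesc u^-1 s.
Proof. by move=> Ss; rewrite /ldesc /rdesc -lenV invgM (simpleV Ss) lenV. Qed.

Lemma rdescV u s : S s -> rdesc u s = ldesc u^-1 s.
Proof. by move=> Ss; rewrite ldescV // invgK. Qed.

Lemma reflection_simple s : S s -> reflection S s.
Proof. by move=> Ss; exists 1, s; rewrite mul1g invg1 mulg1. Qed.

(** [N w s] and [N (s * w) s] are opposite, so [s] is a left descent of exactly one of [w] and
    [s * w]; equal lengths would make it a descent of neither. *)
Lemma len_simple_neq s w : S s -> l (s * w) <> l w.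
Proof.
have [N [NM NS]] := inversion_cocycle => Ss eq_l.
have sr := reflection_simple Ss.
have := inversionP NM NS w sr; have := inversionP NM NS (s * w) sr.
rewrite simpleKl // eq_l ltnn NM NS // eqxx [s ^ s]conjgE mulgA mulVg mul1g.
by move=> + E; rewrite E.
Qed.

Lemma ldescN s w : S s -> ~~ ldesc w s -> l (s * w) = (l w).+1.
Proof.
move=> Ss; have := lenM s w; have := lenMV s w; have := @len_simple_neq s w Ss.
by rewrite /ldesc (len_simple Ss); lia.
Qed.

Lemma ldesc_len s w : S s -> ldesc w s -> l w = (l (s * w)).+1.
Proof. by move=> Ss; have := lenMV s w; rewrite /ldesc (len_simple Ss); lia. Qed.

Lemma rdescN s w : S s -> ~~ rdesc w s -> l (w * s) = (l w).+1.
Proof.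
move=> Ss; rewrite rdescV // => /ldescN -/(_ Ss).
by rewrite lenV => <-; rewrite -[in RHS]lenV invgM invgK (simpleV Ss).
Qed.

Lemma rdesc_len s w : S s -> rdesc w s -> l w = (l (w * s)).+1.
Proof. by move=> Ss; have := lenVM w s; rewrite /rdesc (len_simple Ss); lia. Qed.

Lemma rdescMs s w : S s -> rdesc (w * s) s = ~~ rdesc w s.
Proof.
move=> Ss; rewrite /rdesc simpleK // -leqNgt.
have := @rdescN s w Ss; rewrite /rdesc; case: leqP; lia.
Qed.

Lemma rdesc_exists x : x <> 1 -> exists2 s, S s & rdesc x s.
Proof.
move=> x1; have [p [Sp szp xp]] := reduced_word x.
case/lastP: p Sp szp xp => [|p s]; first by rewrite big_nil.
rewrite -cats1 => /is_word_cat[Sp /is_word_cons[Ss _]] szp xp.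
exists s => //; rewrite /rdesc -szp xp big_cat big_seq1 /= (simpleK _ Ss).
by rewrite size_cat addn1 ltnS len_word.
Qed.

(** * Cosets of dihedral subgroups *)

(* A pair of generators is a map J : bool -> W, so that ~~ b names the generator
   other than J b; [alt b n] and [ralt b n] are the alternating words of length n
   that start, resp. end, with J b. *)
Section Dihedral.
Variable J : bool -> W.
Hypothesis SJ : forall b, S (J b).

Fixpoint ralt b n := if n is n'.+1 then ralt (~~ b) n' * J b else 1.
Fixpoint alt b n := if n is n'.+1 then J b * alt (~~ b) n' else 1.

Lemma raltS b n : ralt b n.+1 = ralt (~~ b) n * J b. Proof. by []. Qed.
Lemma altS b n : alt b n.+1 = J b * alt (~~ b) n. Proof. by []. Qed.

Lemma raltV b n : (ralt b n)^-1 = alt b n.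
Proof.
elim: n b => [|n IHn] b /=; first by rewrite invg1.
by rewrite invgM (simpleV (SJ b)) IHn.
Qed.

Lemma altV b n : (alt b n)^-1 = ralt b n.
Proof. by rewrite -raltV invgK. Qed.

Lemma raltD b m n : ralt b (m + n) = ralt (odd n (+) b) m * ralt b n.
Proof.
elim: n b => [|n IHn] b; first by rewrite addn0 mulg1.
by rewrite addnS /= IHn mulgA addbN addNb.
Qed.

Lemma altD b m n : alt b (m + n) = alt b m * alt (odd m (+) b) n.
Proof. by rewrite addnC -raltV raltD invgM !raltV. Qed.

Lemma alt_ralt b n : alt b n = ralt (odd n (+) ~~ b) n.
Proof.
elim: n b => [|n IHn] b //; rewrite altS IHn negbK -add1n raltD.
have -> : odd (1 + n) (+) ~~ b = odd n (+) b by rewrite add1n addNb addbN negbK.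
by rewrite addbA addbb addFb /= mul1g.
Qed.

Lemma alt_even_neg b k : alt (~~ b) k.*2 = (alt b k.*2)^-1.
Proof. by rewrite alt_ralt altV odd_double negbK. Qed.

(** [alt true k.*2] is the [k]-th power of [J true * J false], so the order of this product is
    infinite or at least [n]. Alternating words of length at most [n] are then reduced. *)
Definition distinct_powers n :=
  forall k, 0 < k < n -> alt true k.*2 <> 1.

Lemma distinct_powersP n b k : distinct_powers n -> 0 < k < n -> alt b k.*2 <> 1.
Proof.
move=> Jn kn; case: b; first exact: Jn.
by move/eqP; rewrite (alt_even_neg true) invg_eq1 => /eqP; exact: Jn.
Qed.

Lemma distinct_powersW m n : m <= n -> distinct_powers n -> distinct_powers m.
Proof. by move=> mn Jn k km; apply: Jn; lia. Qed.

(* J true * J false has order m. *)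
Definition braid m := [/\ 0 < m, alt true m.*2 = 1 & distinct_powers m].

Lemma braid_alt m b : braid m -> alt b m.*2 = 1.
Proof.
by move=> [_ altm _]; case: b; rewrite // (alt_even_neg true) altm invg1.
Qed.

Lemma braid_distinct m n : braid m -> distinct_powers n -> n <= m.
Proof.
move=> [m_gt0 altm _] Jn; rewrite leqNgt; apply/negP => mn.
by apply: (Jn m) => //; rewrite m_gt0.
Qed.

Lemma braid_unique m n : braid m -> braid n -> m = n.
Proof.
move=> bm bn; apply/eqP; rewrite eqn_leq.
by rewrite (braid_distinct bn) 1?(braid_distinct bm) //; [case: bn|case: bm].
Qed.

(** The trivial alternating word of length [m.*2] is cut into two halves, which are inverse to each
    other. *)
Lemma braid_ralt m b b' : braid m -> ralt b m = ralt b' m.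
Proof.
move=> bm; have {}bm (d : bool) : ralt (~~ d) m = ralt d m.
  have := braid_alt (odd m (+) d) bm; rewrite -addnn altD => /mulg1_eq.
  rewrite altV alt_ralt.
  by case: (odd m); case: d => /= ->.
by case: b b' => -[]; rewrite // -[LHS]bm.
Qed.

Lemma braid_alt_ralt m b b' : braid m -> alt b m = ralt b' m.
Proof. by move=> bm; rewrite alt_ralt; exact: braid_ralt. Qed.

Definition dih y := exists b n, y = ralt b n.

Lemma dih1 : dih 1. Proof. by exists true, 0%N. Qed.

Lemma dihMJ y b : dih y -> dih (y * J b).
Proof.
move=> [b' [[|n] ->]]; first by exists b, 1%N; rewrite /= !mul1g.
have [->|/negPf bb'] := eqVneq b b'.
  by exists (~~ b'), n; rewrite raltS simpleK.
exists b, n.+2; rewrite (raltS b); congr (ralt _ _ * _).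
by case: b b' bb' => -[].
Qed.

Lemma dihM y z : dih y -> dih z -> dih (y * z).
Proof.
move=> yJ [b [n ->]]; elim: n b => [|n IHn] b; first by rewrite mulg1.
by rewrite raltS mulgA; apply: dihMJ.
Qed.

Lemma dihV y : dih y -> dih y^-1.
Proof. by move=> [b [n ->]]; rewrite raltV alt_ralt; eexists _, n. Qed.

Lemma dih_ralt b n : dih (ralt b n). Proof. by exists b, n. Qed.
Lemma dih_alt b n : dih (alt b n). Proof. by rewrite alt_ralt; exact: dih_ralt. Qed.

Lemma dih_distinct y : dih y -> exists b n, y = ralt b n /\ distinct_powers n.
Proof.
move=> [b [n]]; elim/ltn_ind: n y b => n IHn y b ->.
have [Jn|/existsNP[k /not_implyP[/andP[k_gt0 kn] /contrapT altk]]] :=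
  pselect (distinct_powers n); first by exists b, n.
have {}altk (d : bool) : ralt d k.*2 = 1.
  apply/invg_inj; rewrite raltV invg1.
  by case: d; rewrite // (alt_even_neg true) altk invg1.
have [kk_n|n_kk] := leqP k.*2 n.
  apply: (IHn (n - k.*2)%N _ _ b); first by lia.
  by rewrite -{1}(subnK kk_n) raltD altk mulg1 odd_double.
have kk_eq : k.*2 = (k.*2 - n + n)%N by lia.
have := altk b; rewrite kk_eq raltD => /mulg1_eq <-; rewrite raltV alt_ralt.
by apply: (IHn (k.*2 - n)%N); [lia|].
Qed.

Lemma len_ralt b n : l (ralt b n) <= n.
Proof.
elim: n b => [|n IHn] b; first by rewrite len1.
by rewrite (leq_trans (lenM _ _)) //= (len_simple (SJ b)) addn1 ltnS IHn.
Qed.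

Lemma len_alt b n : l (alt b n) <= n.
Proof. by rewrite alt_ralt len_ralt. Qed.

(** Minimality of [c] in its coset of the dihedral subgroup, tested on the two letters only;
    [rmin_coset_min] passes to the whole coset. *)
Definition rmin c := forall b, ~~ rdesc c (J b).
Definition lmin u := forall b, ~~ ldesc u (J b).

Lemma lminV u : lmin u <-> rmin u^-1.
Proof. by split=> H b; have := H b; rewrite ldescV. Qed.

Lemma rminV u : rmin u <-> lmin u^-1.
Proof. by rewrite lminV invgK. Qed.

Let coset_min c := forall y, dih y -> l c <= l (c * y).

(** If appending [J b] did not increase the length, the cocycle identity would make [J b] an
    inversion of the alternating word, which yields a forbidden trivial power, or make an element of
    the dihedral subgroup an inversion of [c^-1], against the minimality of [c]. *)
Let len_coset_min c b n : coset_min c -> distinct_powers n ->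
  l (c * ralt b n) = (l c + n)%N.
Proof.
have [N [NM NS]] := inversion_cocycle => c_min.
elim: n b => [|n IHn] b Jn; first by rewrite mulg1 addn0.
rewrite raltS mulgA rdescN //; first by rewrite IHn ?addnS //; apply: distinct_powersW Jn.
rewrite rdescV // /ldesc -(inversionP NM NS); last exact: reflection_simple.
rewrite invgM raltV NM negb_add; apply/eqP.
have -> : N (alt (~~ b) n) (J b) = false.
  have N_alt m b' t : N (alt b' m) t -> exists2 i, i < m & t = alt b' i.*2.+1.
    elim: m b' t => [|m IHm] b' t.
      by have := NM 1 1 t; rewrite mulg1 conjg1 addbb => ->.
    rewrite altS NM NS //; have [->|_ /= /IHm[i im ti]] := eqVneq.
      by exists 0%N; rewrite //= mulg1.
    have alt_eq : alt b' i.*2.+3 = J b' * (alt (~~ b') i.*2.+1 * J b').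
      have := altD (~~ b') i.*2.+1 1; rewrite addn1 [odd _]/= odd_double addTb negbK.
      by rewrite [alt b' 1]/= mulg1 => <-.
    exists i.+1 => //; rewrite -[RHS]/(alt b' i.+1.*2.+1) doubleS alt_eq -ti.
    rewrite conjgE (simpleV (SJ b')).
    by rewrite -mulgA !simpleK // simpleKl.
  apply/negP => /N_alt[i im Jb]; apply: (@distinct_powersP _ b i.+1 Jn) => //.
  by rewrite doubleS altS -Jb simple_sq.
apply/esym/negP => Nc.
have := inversion_len NM NS Nc; rewrite -lenV invgM invgK lenV ltnNge.
apply/negP/negPn/c_min/dihV; rewrite conjgE.
by apply: dihM; [exact/dihV/dih_alt|rewrite -[J b]mul1g; apply/dihM/dih_alt/dihMJ/dih1].
Qed.

Lemma dih_coset x : exists c b n,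
  [/\ coset_min c, x = c * ralt b n & distinct_powers n].
Proof.
have ex_n : exists n, `[< exists2 y, dih y & l (x * y) = n >].
  by exists (l x); apply/asboolP; exists 1; rewrite ?mulg1 //; exact: dih1.
case: (ex_minnP ex_n) => m /asboolP[y yJ m_eq] m_min.
have [b [n [y_eq Jn]]] := dih_distinct (dihV yJ).
exists (x * y), b, n; split=> //; last by rewrite -y_eq mulgK.
move=> z zJ; rewrite m_eq -mulgA; apply/m_min/asboolP.
by exists (y * z) => //; exact: dihM.
Qed.

(** Write [c] as a shortest coset element times an alternating word: if that word is not empty, its
    last letter is a right descent of [c]. *)
Let rmin_coset_min c : rmin c -> coset_min c.
Proof.
move=> c_rmin; have [d [b [[|n] [d_min c_eq Jn]]]] := dih_coset c.
  by rewrite c_eq mulg1.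
have := c_rmin b; rewrite c_eq /rdesc len_coset_min // raltS mulgA simpleK //.
by rewrite len_coset_min ?addnS ?ltnS ?leqnn //; apply: distinct_powersW Jn.
Qed.

Lemma len_rmin c b n : rmin c -> distinct_powers n ->
  l (c * ralt b n) = (l c + n)%N.
Proof. by move=> /rmin_coset_min; exact: len_coset_min. Qed.

Lemma rmin_decomposition x : exists c b n,
  [/\ rmin c, x = c * ralt b n, distinct_powers n & l x = (l c + n)%N].
Proof.
have [c [b [n [c_min x_eq Jn]]]] := dih_coset x.
exists c, b, n; split=> //; last by rewrite x_eq len_coset_min.
by move=> d; rewrite /rdesc -leqNgt; apply/c_min; rewrite -[J d]mul1g; exact/dihMJ/dih1.
Qed.

Lemma len_lmin u b n : lmin u -> distinct_powers n ->
  l (alt b n * u) = (n + l u)%N.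
Proof.
move=> /lminV u_min Jn; rewrite -lenV invgM altV len_rmin // lenV; exact: addnC.
Qed.

Lemma lmin_decomposition u : exists b n u',
  [/\ lmin u', u = alt b n * u', distinct_powers n & l u = (n + l u')%N].
Proof.
have [c [b [n [c_min u_eq Jn lu]]]] := rmin_decomposition u^-1.
exists b, n, c^-1; split=> //; first by apply/rminV.
  by rewrite -raltV -invgM -u_eq invgK.
by rewrite -lenV lu lenV addnC.
Qed.

Lemma rdesc_ralt c b n : rmin c -> distinct_powers n.+1 ->
  rdesc (c * ralt b n.+1) (J b).
Proof.
move=> c_min Jn; rewrite /rdesc len_rmin // raltS mulgA simpleK //.
by rewrite len_rmin ?addnS //; apply: distinct_powersW Jn.
Qed.

(** If the [n] powers extended to [n.+1] distinct ones, appending [J (~~ b)] would give a longer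
    reduced alternating tail instead of a descent. *)
Lemma rdesc_ralt_neg c b n : rmin c -> distinct_powers n -> 0 < n ->
  rdesc (c * ralt b n) (J (~~ b)) -> braid n.
Proof.
move=> c_min Jn n_gt0; rewrite /rdesc len_rmin // => lt_l; split=> //.
have [Jn1|] := pselect (distinct_powers n.+1).
  move: lt_l; rewrite -mulgA -{1}[b]negbK -raltS len_rmin //.
  by rewrite addnS ltnNge leqnSn.
move=> /existsNP[k /not_implyP[/andP[k_gt0 kn] /contrapT altk]].
have [kn'|] := ltnP k n; first by case: (Jn k) => //; rewrite k_gt0.
by move=> nk; have -> : n = k by lia.
Qed.

(** Two right descents force the dihedral subgroup to be finite and the tail of [x] to be its
    longest element, which can be written to end with either letter. *)
Lemma rdesc_both x : rdesc x (J true) -> rdesc x (J false) -> exists c m,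
  [/\ rmin c, braid m, forall b, x = c * ralt b m & l x = (l c + m)%N].
Proof.
move=> xt xf; have xJ b : rdesc x (J b) by case: b.
have [c [b [[|n] [c_min x_eq Jn lx]]]] := rmin_decomposition x.
  by have := c_min true; rewrite -[c]mulg1 -x_eq xJ.
have bm : braid n.+1.
  by have := rdesc_ralt_neg (b := b) c_min Jn isT; rewrite -x_eq; apply.
by exists c, n.+1; split=> // b'; rewrite x_eq (braid_ralt _ b' bm).
Qed.

End Dihedral.

(** * Products that are not reduced *)

Section Noncommuting.
Hypothesis noncommuting : forall s t, S s -> S t -> s <> t -> s * t <> t * s.

Definition letters (s t : W) (b : bool) := if b then s else t.

Lemma letters_simple s t : S s -> S t -> forall b, S (letters s t b).
Proof. by move=> Ss St []. Qed.

Lemma braid_ge3 J m : (forall b, S (J b)) -> J true <> J false ->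
  braid J m -> 2 < m.
Proof.
move=> SJ J_neq [+ + _]; case: m => [|[|[|m]]] //= _.
  by rewrite mulg1 => /mulg1_eq; rewrite simpleV.
rewrite mulg1 !mulgA => /mulg1_eq E.
have tft : J true * J false * J true = J false.
  by apply: invg_inj; rewrite E simpleV.
by case: (noncommuting (SJ true) (SJ false) J_neq); rewrite -{2}tft simpleK.
Qed.

(** Noncommutation makes the longest element of the dihedral subgroup have length at least 3, so
    three letters can be removed from the end of [x] in turn. *)
Lemma rdesc_both_step s t x : S s -> S t -> s <> t -> rdesc x s -> rdesc x t ->
  rdesc (x * s) t /\ rdesc (x * s * t) s.
Proof.
move=> Ss St st xs xt; pose J := letters s t.
have SJ : forall b, S (J b) by exact: letters_simple.
have [c [m [c_min bm x_eq _]]] := @rdesc_both J SJ x xs xt.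
have m_gt2 := braid_ge3 SJ st bm; have [_ _ Jm] := bm.
case: m m_gt2 {bm} x_eq Jm => [|[|[|m]]] // _ x_eq Jm.
have xs_eq : x * s = c * ralt J false m.+2.
  by rewrite (x_eq true) raltS mulgA simpleK.
have xst_eq : x * s * t = c * ralt J true m.+1.
  by rewrite xs_eq raltS mulgA simpleK.
rewrite xst_eq xs_eq; split.
  by apply: (@rdesc_ralt J SJ c false) => //; apply: distinct_powersW Jm.
by apply: (@rdesc_ralt J SJ c true) => //; apply: distinct_powersW Jm; lia.
Qed.

(* If the conclusion failed then x s, r, t would violate it as well, with s in
   the role of t, so there would be an infinite descent. *)
Lemma rdesc_after_both s r t x : S s -> S r -> S t -> s <> r ->
  rdesc x s -> rdesc x r -> rdesc (x * s) t -> t = r.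
Proof.
have [n] := ubnP (l x); elim: n => // n IHn in s r t x *.
rewrite ltnS => lx Ss Sr St sr xs xr xst; apply: contrapT => tr.
have [xsr xsrs] := rdesc_both_step Ss Sr sr xs xr.
have st : s = t.
  apply: (IHn r t s (x * s)) => //; last exact/nesym.
  by rewrite (leq_trans _ lx) // (rdesc_len Ss xs).
by move: xst; rewrite -st rdescMs // xs.
Qed.

(** The alternating prefix of [u] cannot start with [J b], and it cannot be the longest element,
    which has both letters as left descents. *)
Lemma lmin_alt J b u : (forall b, S (J b)) ->
    ~~ ldesc u (J b) -> ldesc u (J (~~ b)) ->
  exists n u', [/\ lmin J u', u = alt J (~~ b) n * u', distinct_powers J n,
    l u = (n + l u')%N & forall m, braid J m -> 0 < n < m].
Proof.
move=> SJ ub unb; have [b' [n [u' [u'_min u_eq Jn lu]]]] := lmin_decomposition SJ u.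
have n_gt0 : 0 < n.
  case: n u_eq {lu Jn} => // u_eq.
  by have := u'_min (~~ b); rewrite -[u']mul1g -u_eq unb.
have starts (d : bool) : u = alt J d n * u' -> ldesc u (J d).
  move=> ud; rewrite /ldesc lu {1}ud -(prednK n_gt0) altS -mulgA simpleKl //.
  by rewrite len_lmin // ?addSn //; apply: distinct_powersW Jn; lia.
have b'b : b' = ~~ b.
  have := starts b' u_eq.
  by case: b b' {u_eq starts} ub unb => -[] // /negPf->.
exists n, u'; split=> //; first by rewrite -b'b.
move=> m bm; rewrite n_gt0 ltn_neqAle (braid_distinct bm Jn) andbT.
apply/eqP => nm; move: ub; rewrite (starts b) //.
by rewrite u_eq nm (braid_alt_ralt SJ b' true bm) (braid_alt_ralt SJ b true bm).
Qed.

(* Let u1 g be the shortest prefix of u such that x u1 g is not reduced, and p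
   the last letter of u1. Then x u1 = c w with w the longest element of <p, g>.
   Write u1 = d a with a in <p, g> and d minimal: a right descent q of x d outside
   <p, g> (the last letter of d, or s if d = 1) would force w a^-1 to be a single
   letter h, by [rdesc_after_both], and d h would be a shorter prefix of u with
   x d h not reduced. *)
Lemma not_reduced s x u : S s -> rdesc x s -> ~~ ldesc u s ->
    l (x * u) <> (l x + l u)%N ->
  exists J b m k n c u', [/\ [/\ forall b, S (J b), J b = s & J true <> J false],
    [/\ braid J m, rmin J c & lmin J u'],
    [/\ x = c * ralt J b k, l x = (l c + k)%N, u = alt J (~~ b) n * u' &
        l u = (n + l u')%N] &
    [/\ k <= m, n < m & m < k + n]].
Proof.
move=> Ss xs us xu.
pose prefix v := l u = (l v + l (v^-1 * u))%N.
have ex_j : exists j, `[< exists v,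
    [/\ l v = j, prefix v & l (x * v) <> (l x + l v)%N] >].
  exists (l u); apply/asboolP; exists u; split=> //.
  by rewrite /prefix mulVg len1 addn0.
case: (ex_minnP ex_j) => j /asboolP[v [vj pre_v xv]] j_min.
have red v' : prefix v' -> l v' < j -> l (x * v') = (l x + l v')%N.
  move=> pre_v' v'j; apply: contrapT => xv'.
  have /asboolP/j_min : exists v,
      [/\ l v = l v', prefix v & l (x * v) <> (l x + l v)%N] by exists v'.
  by rewrite leqNgt v'j.
have [g Sg vg] : exists2 g, S g & rdesc v g.
  by apply: rdesc_exists => v1; apply: xv; rewrite v1 mulg1 len1 addn0.
have lv := rdesc_len Sg vg.
pose u1 := v * g.
have pre_u1 : prefix u1.
  rewrite /prefix; have := lenM u1 (u1^-1 * u); rewrite mulVKg.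
  have -> : u1^-1 * u = g * (v^-1 * u) by rewrite /u1 invgM (simpleV Sg) mulgA.
  by have := lenM g (v^-1 * u); move: pre_v; rewrite /prefix (len_simple Sg) lv /u1; lia.
have v_eq : v = u1 * g by rewrite /u1 simpleK.
have xu1 : l (x * u1) = (l x + l u1)%N by apply: red => //; rewrite -vj lv.
have xu1g : rdesc (x * u1) g.
  apply: contra_notT xv => /(rdescN Sg).
  by rewrite -mulgA -v_eq => ->; rewrite xu1 lv addnS.
have u1g : ~~ rdesc u1 g by rewrite rdescMs // vg.
(* If [u1 = 1], then [s] and [g] are both right descents of [x], so [x] itself ends with the longest
   element of their subgroup and [k = m]. *)
have [u1_1|/rdesc_exists[p Sp u1p]] := pselect (u1 = 1).
  have ug : ldesc u g.
    move: pre_v; rewrite /prefix v_eq u1_1 mul1g (simpleV Sg) (len_simple Sg).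
    by rewrite /ldesc => ->; rewrite add1n.
  have xg : rdesc x g by rewrite -[x]mulg1 -u1_1.
  have sg : s <> g by move=> sg; move: us; rewrite sg ug.
  have SJ := letters_simple Ss Sg.
  have [c [m [c_min bm x_eq lx]]] := rdesc_both SJ xs xg.
  have [n [u' [u'_min u_eq Jn lu n_m]]] := lmin_alt (b := true) SJ us ug.
  have /andP[n_gt0 nm] := n_m m bm.
  exists (letters s g), true, m, m, n, c, u'; split=> //.
  by split=> //; rewrite -[ltnLHS]addn0 ltn_add2l.
have pg : p <> g by move=> pg; move: u1g; rewrite -pg u1p.
have xu1p : rdesc (x * u1) p.
  by rewrite /rdesc -mulgA (leq_ltn_trans (lenM _ _)) // xu1 ltn_add2l.
pose J := letters p g; have SJ : forall b, S (J b) := letters_simple Sp Sg.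
have [c [m [c_min bm xu1_eq _]]] := rdesc_both SJ xu1p xu1g.
have [d [b [i [d_min u1_eq Ji lu1]]]] := rmin_decomposition SJ u1.
have i_gt0 : 0 < i.
  case: i u1_eq {Ji lu1} => // u1_d.
  by have := d_min true; rewrite -[d]mulg1 -u1_d u1p.
have u1_end (e : bool) : u1 = d * ralt J e i -> rdesc u1 (J e).
  by move=> ->; rewrite -(prednK i_gt0); apply: rdesc_ralt; rewrite // prednK.
have b_true : b = true.
  by case: b {u1_eq} (u1_end b u1_eq) => // u1_g; rewrite u1_g in u1g.
rewrite {b}b_true in u1_eq.
have im : i < m.
  rewrite ltn_neqAle (braid_distinct bm Ji) andbT; apply/eqP => im.
  have := u1_end false; rewrite im (braid_ralt SJ false true bm) -im -u1_eq.
  by move=> /(_ erefl); apply/negP.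
have Jmi : distinct_powers J (m - i).
  by case: bm => _ _; apply: distinct_powersW; exact: leq_subr.
(* By [raltD], this is the last letter left when the final [i] letters of [ralt J true m] are
   removed. *)
pose h := ~~ odd i.
have xd_eq : x * d = c * ralt J h (m - i).
  apply: (mulIg (ralt J true i)); rewrite -mulgA -u1_eq (xu1_eq true).
  by rewrite -{1}(subnK (ltnW im)) raltD // addbT mulgA.
have mi_gt0 : 0 < m - i by rewrite subn_gt0.
have xdh : rdesc (x * d) (J h).
  by rewrite xd_eq -(prednK mi_gt0); apply: rdesc_ralt; rewrite // prednK.
have lxd : (l x + l d <= l (x * d))%N.
  rewrite -(leq_add2r i) -addnA -lu1 -xu1 u1_eq mulgA.
  by rewrite (leq_trans (lenM _ _)) // leq_add2l len_ralt.
have v_ralt : v = d * ralt J false i.+1 by rewrite raltS v_eq u1_eq mulgA.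
have xd_desc q : S q -> rdesc (x * d) q -> exists b, q = J b.
  move=> Sq xdq; apply: contrapT => qJ.
  have Jhq : J h <> q by move=> hq; apply: qJ; exists h.
  (* If two letters of the subgroup could still be removed from [x * d], [rdesc_after_both] would
     identify [q] with [J (~~ h)]. *)
  have mi1 : m = i.+1.
    have [|mi_gt1] := leqP (m - i) 1; first by move: mi_gt0; clear; lia.
    case: qJ; exists (~~ h); apply/esym.
    apply: (rdesc_after_both (SJ h) Sq (SJ _) Jhq xdh xdq).
    have -> : x * d * J h = c * ralt J (~~ h) (m - i).-1.
      by rewrite xd_eq -{1}(prednK mi_gt0) raltS mulgA simpleK.
    have mi1_gt0 : 0 < (m - i).-1 by rewrite -ltnS prednK.
    rewrite -(prednK mi1_gt0); apply: rdesc_ralt => //.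
    by apply: distinct_powersW Jmi; rewrite prednK // leq_pred.
  (* This prefix of [u] is shorter than [v], so its product with [x] is reduced; but [J h] is a
     right descent of [x * d]. *)
  have [v' v'E] : exists v', v' = d * J h by exists (d * J h).
  have v_v' : v = v' * alt J (~~ h) i.
    rewrite v_ralt -mi1 -(braid_alt_ralt SJ h false bm) mi1 altS.
    by rewrite v'E mulgA.
  have v'u : v'^-1 * u = alt J (~~ h) i * (v^-1 * u).
    by rewrite v_v' invgM -!mulgA mulVKg.
  have := lenM (alt J (~~ h) i) (v^-1 * u); rewrite -v'u.
  have := len_alt SJ (~~ h) i; have := lenM v' (v'^-1 * u); rewrite mulVKg.
  have := lenM d (J h); rewrite -v'E (len_simple (SJ h)) => lv' lu_le la lv'u.
  move: pre_v; rewrite /prefix lv lu1 => pre_v.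
  have pre_v' : prefix v'.
    by rewrite /prefix; move: pre_v lv'u la lv' lu_le; clear; lia.
  have v'j : l v' < j by rewrite -vj lv lu1; move: lv' i_gt0; clear; lia.
  have xdJ : l (x * d * J h) = (l x + l v')%N by rewrite -mulgA -v'E red.
  move: xdh pre_v' (lenM x d) pre_v lv'u la; rewrite /rdesc /prefix xdJ.
  by clear; lia.
have d1 : d = 1.
  apply: contrapT => /rdesc_exists[q Sq dq].
  have [|b qb] := xd_desc q Sq; last by have := d_min b; rewrite -qb dq.
  by rewrite /rdesc -mulgA (leq_ltn_trans (lenM _ _)) // (leq_trans _ lxd) // ltn_add2l.
move: xd_desc xd_eq v_ralt lu1.
rewrite d1 mulg1 mul1g len1 add0n => xd_desc xd_eq v_ralt lu1.
have [b sb] := xd_desc s Ss xs.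
have Jh : J h = s.
  have [->//|bh] := eqVneq h b; have {}bh : b = ~~ h by move: bh; case: (b) (h) => -[].
  have := rdesc_ralt_neg (b := h) SJ c_min Jmi mi_gt0; rewrite -xd_eq -bh -sb => /(_ xs).
  move=> /(braid_unique bm) m_mi; suff: false by [].
  by move: m_mi i_gt0 mi_gt0; clear; lia.
have v_alt : v = alt J (~~ h) i.+1.
  by rewrite v_ralt alt_ralt // negbK /h /= addbb.
have uh : ldesc u (J (~~ h)).
  rewrite /ldesc.
  have -> : J (~~ h) * u = alt J h i * (v^-1 * u).
    by rewrite -{1}[u](mulVKg v) {1}v_alt altS negbK -mulgA simpleKl.
  rewrite pre_v (leq_ltn_trans (lenM _ _)) // ltn_add2r lv lu1 ltnS.
  exact: len_alt.
have uNh : ~~ ldesc u (J h) by rewrite Jh.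
have [n [u' [u'_min u_eq Jn lu n_m]]] := lmin_alt SJ uNh uh.
have /andP[n_gt0 nm] := n_m m bm.
exists J, h, m, (m - i)%N, n, c, u'; split=> //.
  by split=> //; rewrite xd_eq len_rmin.
split=> //; first exact: leq_subr.
(* If [n <= i], the alternating prefix [v] of length [i.+1] reaches into [u'], and its next letter
   [J f] would be a left descent of [u']. *)
have [ni|] := leqP n i; last by move: im; clear; lia.
pose f := odd n (+) ~~ h.
have u'_eq : u' = alt J f (i - n).+1 * (v^-1 * u).
  apply: (mulgI (alt J (~~ h) n)); rewrite -u_eq mulgA -altD //.
  by rewrite addnS subnKC // -v_alt mulVKg.
have Jfu' : J f * u' = alt J (~~ f) (i - n) * (v^-1 * u).
  by rewrite u'_eq altS -mulgA simpleKl.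
have := u'_min f; rewrite /ldesc Jfu' -leqNgt => u'_le.
have := leq_trans u'_le (lenM _ _); have := len_alt SJ (~~ f) (i - n).
by move: pre_v ni; rewrite /prefix lu lv lu1; clear; lia.
Qed.

Lemma rdesc_ralt_tail J c b n : (forall b, S (J b)) -> rmin J c ->
  distinct_powers J n.+2 -> rdesc (c * ralt J b n.+2 * J b) (J (~~ b)).
Proof.
move=> SJ c_min Jn; rewrite raltS mulgA simpleK //.
by apply: rdesc_ralt => //; apply: distinct_powersW Jn.
Qed.

Lemma rdesc_ralt_tail2 J c b n : (forall b, S (J b)) -> rmin J c ->
  distinct_powers J n.+3 ->
  rdesc (c * ralt J b n.+3 * J b * J (~~ b)) (J b).
Proof.
move=> SJ c_min Jn; rewrite raltS mulgA simpleK // raltS mulgA simpleK // negbK.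
by apply: rdesc_ralt => //; apply: distinct_powersW Jn; lia.
Qed.

Lemma ldesc_alt J u b n : (forall b, S (J b)) -> lmin J u ->
  distinct_powers J n.+1 -> ldesc (alt J b n.+1 * u) (J b).
Proof.
move=> SJ u_min Jn; rewrite /ldesc altS -mulgA simpleKl // mulgA -altS.
by rewrite !len_lmin //; apply: distinct_powersW Jn.
Qed.

(** Both [J (~~ b)] and the first letter [J' (~~ b')] of [u] are right descents of [x * J b], and
    they differ because only the second is a left descent of [u]. By [rdesc_after_both], a third
    letter in the tail of [x], for [J] or for [J'], would make [J b] equal to one of them. *)
Lemma not_reduced_coset J c b n u : (forall b, S (J b)) -> J true <> J false ->
    rmin J c -> lmin J u -> distinct_powers J n.+2 ->
    l (c * ralt J b n.+2 * u) <> (l (c * ralt J b n.+2)%g + l u)%N ->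
  n = 0%N /\ exists J' b' m c' u',
   [/\ [/\ forall b, S (J' b), J' b' = J b & J' true <> J' false],
       [/\ braid J' m, rmin J' c' & lmin J' u'],
       c * ralt J b n.+2 = c' * ralt J' b' 2,
       u = alt J' (~~ b') m.-1 * u' &
       l u = (m.-1 + l u')%N].
Proof.
move=> SJ J_neq c_min u_min Jn xu; set x := c * ralt J b n.+2 in xu *.
have neg_neq (K : bool -> W) d : K true <> K false -> K d <> K (~~ d).
  by case: d => // K_neq /esym.
have xs : rdesc x (J b) by apply: rdesc_ralt.
have [J' [b' [m [k [n' [c' [u' [[SJ' J'b J'_neq] [bm c'_min u'_min]
  [x_eq lx u_eq lu] [km n'm mkn]]]]]]]]] := not_reduced (SJ b) xs (u_min b) xu.
have [_ _ Jm] := bm; have {}Jm i : i <= m -> distinct_powers J' i.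
  by move=> im; apply: distinct_powersW Jm.
have ut : ldesc u (J' (~~ b')).
  have n'_gt0 : 0 < n' by lia.
  rewrite u_eq -(prednK n'_gt0); apply: ldesc_alt => //.
  by rewrite prednK //; exact/Jm/ltnW.
have tJ : J (~~ b) <> J' (~~ b').
  by move=> t_eq; have := u_min (~~ b); rewrite t_eq ut.
have xst : rdesc (x * J b) (J (~~ b)) by exact: rdesc_ralt_tail.
case: k x_eq lx km mkn => [|[|k]] x_eq lx km mkn; [by lia|by lia|].
have xst' : rdesc (x * J b) (J' (~~ b')).
  by rewrite -J'b x_eq; apply: rdesc_ralt_tail => //; exact: Jm.
have n0 : n = 0%N.
  apply/eqP; rewrite -leqn0 leqNgt; apply/negP => n_gt0.
  case: (neg_neq J' b' J'_neq); rewrite J'b.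
  apply: (rdesc_after_both (SJ (~~ b)) (SJ' (~~ b')) (SJ b) tJ xst xst').
  by have := @rdesc_ralt_tail2 J c b n.-1 SJ c_min; rewrite !prednK //; exact.
have k0 : k = 0%N.
  case: k x_eq lx km mkn => // k x_eq _ km _.
  case: (neg_neq J b J_neq).
  apply: (rdesc_after_both (SJ' (~~ b')) (SJ (~~ b)) (SJ b) (nesym tJ) xst' xst).
  by rewrite -J'b x_eq; apply: rdesc_ralt_tail2 => //; exact: Jm.
split=> //; rewrite k0 in x_eq lx km mkn.
have n'_eq : n' = m.-1 by lia.
by exists J', b', m, c', u'; split; rewrite -?n'_eq.
Qed.

End Noncommuting.

Section Cosets.
Variable J : bool -> W.
Hypothesis SJ : forall b, S (J b).
Variable c : W.
Hypothesis c_min : rmin J c.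

Definition coset z := exists2 y, dih J y & z = c * y.

Lemma cosetMJ z b : coset z -> coset (z * J b).
Proof. by move=> [y yJ ->]; exists (y * J b); [exact: dihMJ|rewrite mulgA]. Qed.

Lemma coset_ralt b n : coset (c * ralt J b n).
Proof. by exists (ralt J b n) => //; exact: dih_ralt. Qed.

Lemma coset_decomposition z : coset z -> exists b n,
  [/\ z = c * ralt J b n, distinct_powers J n & l z = (l c + n)%N].
Proof.
move=> [y /dih_distinct-/(_ SJ)[b [n [-> Jn]]] ->].
by exists b, n; split=> //; exact: len_rmin.
Qed.

End Cosets.

Lemma not_rdesc1 s : ~~ rdesc 1 s.
Proof. by rewrite /rdesc len1. Qed.

(** * Finite dihedral parabolic subgroups and their longest elements *)

Section DihedralParabolic.
Variable J : bool -> W.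
Hypothesis SJ : forall b, S (J b).
Variable m : nat.
Hypothesis bm : braid J m.

Let rmin1 : rmin J 1. Proof. by move=> b; exact: not_rdesc1. Qed.

Lemma len_ralt_braid b n : n <= m -> l (ralt J b n) = n.
Proof.
move=> nm; have [_ _ Jm] := bm.
by have := len_rmin SJ b rmin1 (distinct_powersW nm Jm); rewrite mul1g len1.
Qed.

Lemma generated_dih : generated [set J b | b in [set: bool]] = dih J.
Proof.
apply/seteqP; split.
  apply: smallest_sub; last first.
    by move=> _ [b _ <-]; exists b, 1%N; rewrite /= mul1g.
  split=> [|x y]; rewrite !inE; first exact: dih1.
  by move=> xJ yJ; apply: dihM => //; exact: dihV.
move=> _ [b [n ->]] M [M_sub JM].
elim: n b => [|n IHn] b; first by have [+ _] := M_sub; rewrite inE.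
have := group_closedM M_sub; move=> /(_ (ralt J (~~ b) n) (J b)).
by rewrite !inE; apply; [exact: IHn|apply: JM; exists b].
Qed.

Lemma parabolic_dih : parabolic S (dih J).
Proof.
by exists [set J b | b in [set: bool]]; [move=> _ [b _ <-]|rewrite generated_dih].
Qed.

Lemma dih_braid y : dih J y -> exists b n, y = ralt J b n /\ n <= m.
Proof.
move=> /dih_distinct-/(_ SJ)[b [n [-> Jn]]]; exists b, n; split=> //.
exact: braid_distinct Jn.
Qed.

Lemma finite_dih : finite_set (dih J).
Proof.
apply: (@sub_finite_set _ _
  [set ralt J bn.1 (val bn.2) | bn in [set: bool * 'I_m.+1]]).
  move=> y /dih_braid[b [n [-> nm]]].
  by exists (b, Ordinal (nm : n < m.+1)).
by apply: finite_image; exact: finite_finset.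
Qed.

Lemma longest_dih : longest_element S (dih J) (ralt J true m).
Proof.
split=> [|x /dih_braid[b [n [-> nm]]]]; first exact: dih_ralt.
by rewrite !len_ralt_braid.
Qed.

(** Turns the bound on cardinalities of finite parabolic subgroups into a bound on the orders [m];
    the chosen elements are told apart by their lengths. *)
Lemma card_dih_ge : (`I_m #<= dih J)%card.
Proof.
have inj : set_inj `I_m (ralt J true).
  move=> i j; rewrite !inE => im jm /(congr1 l).
  by rewrite !len_ralt_braid // ltnW.
rewrite -(card_le_eql (inj_card_eq inj)); apply: subset_card_le => _ [i _ <-].
exact: dih_ralt.
Qed.

End DihedralParabolic.

End Coxeter.

(** * Degrees of Laurent polynomials *)

Section LaurentDegree.
Local Open Scope ring_scope.
Implicit Types (x y : laurent) (p q : {poly int}) (d e : int).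

Lemma eval_atD p q x : eval_at (p + q) x = eval_at p x + eval_at q x.
Proof. by rewrite /eval_at rmorphD hornerD. Qed.

Lemma eval_atM p q x : eval_at (p * q) x = eval_at p x * eval_at q x.
Proof. by rewrite /eval_at rmorphM hornerM. Qed.

Lemma eval_atC (c : int) x : eval_at c%:P x = c%:~R.
Proof. by rewrite /eval_at map_polyC hornerC. Qed.

Lemma eval_atX x : eval_at 'X x = x.
Proof. by rewrite /eval_at map_polyX hornerX. Qed.

Lemma eval_atXn n x : eval_at 'X^n x = x ^+ n.
Proof. by rewrite /eval_at map_polyXn hornerXn. Qed.

Lemma eval_at0 x : eval_at 0 x = 0.
Proof. by rewrite /eval_at rmorph0 horner0. Qed.

Lemma eval_at1 x : eval_at 1 x = 1.
Proof. by rewrite /eval_at rmorph1 hornerE. Qed.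

Lemma eval_at_comp p q x : eval_at (p \Po q) x = eval_at p (eval_at q x).
Proof.
elim/poly_ind: p => [|p c IHp]; first by rewrite comp_poly0 !eval_at0.
rewrite comp_polyD comp_polyM comp_polyX comp_polyC !eval_atD !eval_atM.
by rewrite IHp eval_atX !eval_atC.
Qed.

Lemma val_eval_v p : val (eval_at p v_) = tofrac p.
Proof.
elim/poly_ind: p => [|p c IHp]; first by rewrite eval_at0 rmorph0.
rewrite eval_atD eval_atM eval_atX eval_atC [LHS]rmorphD rmorphM rmorph_int /= IHp.
by rewrite tofracD tofracM -[c in RHS]intz !rmorph_int.
Qed.

Lemma eval_v_inj : injective (eval_at^~ v_).
Proof.
by move=> p q /(congr1 val); rewrite !val_eval_v => /eqP; rewrite tofrac_eq => /eqP.
Qed.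

Lemma mul_vX_inj n : injective (fun x => x * v_ ^+ n).
Proof.
move=> x y /(congr1 ( *%R^~ (vinv ^+ n))).
by rewrite -!mulrA -exprMn mul_v_vinv expr1n !mulr1.
Qed.

Lemma laurent_poly x : exists n p, x * v_ ^+ n = eval_at p v_.
Proof.
have /asboolP[n [p xp]] := valP x; exists n, p; apply: val_inj.
by rewrite val_eval_v -xp rmorphM rmorphXn.
Qed.

(** The [+ 1] is there because [size] exceeds the degree by one. Zero has every degree, since [n]
    can be taken large. *)
Definition degle d x := exists n p,
  x * v_ ^+ n = eval_at p v_ /\ (size p)%:Z <= d + n%:Z + 1.

(** The bound does not depend on the chosen fraction: two representations satisfy
    [p * 'X^m = r * 'X^n]. *)
Lemma degle_size d x n p :
  degle d x -> x * v_ ^+ n = eval_at p v_ -> p != 0 -> (size p)%:Z <= d + n%:Z + 1.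
Proof.
move=> [m [r [xr sz_r]]] xp p_neq0.
have pr : p * 'X^m = r * 'X^n.
  apply: eval_v_inj; rewrite /= !eval_atM !eval_atXn -xp -xr.
  by rewrite -!mulrA [X in _ * X]mulrC.
have r_neq0 : r != 0.
  apply: contraNneq p_neq0 => r0; move/eqP: pr.
  by rewrite r0 mul0r mulf_eq0 expf_eq0 polyX_eq0 andbF orbF.
have := congr1 (fun s : {poly int} => size s) pr.
by rewrite !size_mulXn //; lia.
Qed.

Lemma degle0 d : degle d 0.
Proof.
by exists `|d|%N, 0; rewrite mul0r eval_at0 size_poly0; split=> //; lia.
Qed.

Lemma degleD d x y : degle d x -> degle d y -> degle d (x + y).
Proof.
move=> [n [p [xp sz_p]]] [m [r [xr sz_r]]].
exists (n + m)%N, (p * 'X^m + r * 'X^n); split.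
  by rewrite eval_atD !eval_atM !eval_atXn -xp -xr exprD; ring.
have szX (t : {poly int}) k : (size (t * 'X^k)%R <= size t + k)%N.
  by rewrite (leq_trans (size_polyMleq _ _)) // size_polyXn addnS.
have : (size (p * 'X^m + r * 'X^n)%R <= maxn (size p + m) (size r + n))%N.
  by rewrite (leq_trans (size_polyD _ _)) // geq_max !leq_max !szX orbT.
lia.
Qed.

Lemma degleM d e x y : degle d x -> degle e y -> degle (d + e) (x * y).
Proof.
move=> [n [p [xp sz_p]]] [m [r [xr sz_r]]].
have [p0|p_neq0] := eqVneq p 0.
  have -> : x = 0.
    by apply: (@mul_vX_inj n); rewrite /= xp p0 eval_at0 mul0r.
  by rewrite mul0r; exact: degle0.
have [r0|r_neq0] := eqVneq r 0.
  have -> : y = 0.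
    by apply: (@mul_vX_inj m); rewrite /= xr r0 eval_at0 mul0r.
  by rewrite mulr0; exact: degle0.
exists (n + m)%N, (p * r); split.
  by rewrite eval_atM -xp -xr exprD; ring.
have := size_polyMleq p r; move: p_neq0 r_neq0; rewrite -!size_poly_gt0; lia.
Qed.

Lemma degleW d e x : d <= e -> degle d x -> degle e x.
Proof. by move=> de [n [p [xp sz_p]]]; exists n, p; split=> //; lia. Qed.

Lemma degle1 : degle 0 1.
Proof. by exists 0%N, 1; rewrite expr0 mulr1 eval_at1 size_poly1. Qed.

Lemma degleN1 : degle 0 (-1).
Proof.
exists 0%N, (-1)%:P; rewrite expr0 mulr1 eval_atC size_polyC.
by rewrite rmorphN1.
Qed.

Lemma degleN d x : degle d x -> degle d (- x).
Proof. by move=> /(degleM degleN1); rewrite add0r mulN1r. Qed.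

Lemma degle_v : degle 1 v_.
Proof. by exists 0%N, 'X; rewrite expr0 mulr1 eval_atX size_polyX. Qed.

Lemma degle_vinv : degle (-1) vinv.
Proof.
by exists 1%N, 1; rewrite expr1 mulrC mul_v_vinv eval_at1 size_poly1.
Qed.

Lemma degleX d x n : degle d x -> degle (d *+ n) (x ^+ n).
Proof.
move=> xd; elim: n => [|n IHn]; first by rewrite mulr0n expr0; exact: degle1.
by rewrite mulrS exprS; exact: degleM.
Qed.

Lemma degle_vX n : degle n%:Z (v_ ^+ n).
Proof. by have := degleX n degle_v; rewrite natz. Qed.

Lemma degle_vinvX n : degle (- n%:Z) (vinv ^+ n).
Proof. by have := degleX n degle_vinv; rewrite mulNrn natz. Qed.

Lemma degle_q p : degle (2 * (size p).-1)%N%:Z (eval_at p q_).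
Proof.
exists 0%N, (p \Po 'X^2); rewrite expr0 mulr1 eval_at_comp eval_atXn; split=> //.
have := size_comp_poly_leq p 'X^2; rewrite size_polyXn /=; lia.
Qed.

Lemma degle_exists x : exists d, degle d x.
Proof.
have [n [p xp]] := laurent_poly x; exists (size p)%:Z, n, p; split=> //; lia.
Qed.

Lemma degle_eq0 x : (forall d, degle d x) -> x = 0.
Proof.
have [n [p xp]] := laurent_poly x => x_deg.
have [p0|p_neq0] := eqVneq p 0.
  by apply: (@mul_vX_inj n); rewrite /= xp p0 eval_at0 mul0r.
have := degle_size (x_deg (- n%:Z - 1)) xp p_neq0.
by move: p_neq0; rewrite -size_poly_gt0; lia.
Qed.

Lemma has_degree_le d e x : has_degree x d -> degle e x -> d <= e.
Proof.
move=> [n [p [xp p_neq0 ->]]] xe; have := degle_size xe xp p_neq0.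
by move: p_neq0; rewrite -size_poly_gt0; lia.
Qed.

Lemma has_degree1 : has_degree 1 0.
Proof.
exists 0%N, 1; split; rewrite ?expr0 ?mulr1 ?eval_at1 ?oner_neq0 //.
by rewrite size_poly1.
Qed.

End LaurentDegree.

(** * The Hecke algebra *)

Section Decomposition.
Variables (A : nzRingType) (M : lmodType A) (I : choiceType) (b : I -> M).
Local Open Scope ring_scope.

Lemma decomposition_fset (x : M) (c : I -> A) : decomposition b x c <->
  exists2 r : {fset I}, (forall i, i \notin r -> c i = 0) &
    x = \sum_(i <- r) c i *: b i.
Proof.
split=> [[/finite_fsetP[r r_supp] ->]|[r c_r ->]].
  have c_r i : i \notin r -> c i = 0.
    move=> /negP ir; apply: contra_notP ir => /eqP ci.
    by have : [set` r] i by rewrite -r_supp.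
  exists r => //; apply: fsbigTE => i /c_r->.
  by rewrite scale0r.
split; last by apply/esym/fsbigTE => i /c_r->; rewrite scale0r.
apply: (@sub_finite_set _ _ [set` r]); last exact: finite_fset.
move=> i /= /eqP ci; apply: contrapT => /negP ir; exact/ci/c_r.
Qed.

Lemma decompositionD x y c e : decomposition b x c -> decomposition b y e ->
  decomposition b (x + y) (fun i => c i + e i).
Proof.
have widen z f (r r' : {fset I}) : (forall i, i \notin r -> f i = 0) ->
    z = \sum_(i <- r) f i *: b i -> z = \sum_(i <- (r `|` r')%fset) f i *: b i.
  move=> f_r ->; rewrite -!(fsbigTE (r `|` r')%fset) -?(fsbigTE r) //.
    by move=> i /f_r->; rewrite scale0r.
  by move=> i; rewrite in_fsetU negb_or => /andP[/f_r-> _]; rewrite scale0r.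
move=> /decomposition_fset[r c_r x_eq] /decomposition_fset[r' e_r y_eq].
apply/decomposition_fset; exists (r `|` r')%fset.
  by move=> i; rewrite in_fsetU negb_or => /andP[/c_r-> /e_r->]; rewrite addr0.
rewrite (widen _ _ _ r' c_r x_eq) (widen _ _ _ r e_r y_eq) fsetUC -big_split /=.
by apply: eq_bigr => i _; rewrite scalerDl.
Qed.

Lemma decompositionZ a x c : decomposition b x c ->
  decomposition b (a *: x) (fun i => a * c i).
Proof.
move=> /decomposition_fset[r c_r ->]; apply/decomposition_fset; exists r.
  by move=> i /c_r->; rewrite mulr0.
by rewrite scaler_sumr; apply: eq_bigr => i _; rewrite scalerA.
Qed.

Lemma decomposition1 i : decomposition b (b i) (fun j => (j == i)%:R).
Proof.
apply/decomposition_fset; exists [fset i]%fset.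
  by move=> j; rewrite in_fset1 => /negPf->.
by rewrite big_seq_fset1 eqxx scale1r.
Qed.

Lemma decomposition0 : decomposition b 0 (fun=> 0).
Proof. by apply/decomposition_fset; exists fset0; rewrite ?big_seq_fset0. Qed.

End Decomposition.

Section Hecke.
Variables (W : groupType) (S : set W).
Variables (H : algType laurent) (T : W -> H).
Hypothesis coxeterWS : coxeter_system S.
Hypothesis noncommuting : forall s t : W, S s -> S t -> s <> t ->
  (s * t)%g <> (t * s)%g.
Hypothesis heckeH : hecke_algebra S T.
Local Notation l := (len S).
Local Open Scope ring_scope.
Implicit Types (x y z w u c : W) (h : H) (d e : int).

Let basisT : is_basis T. Proof. by case: heckeH. Qed.
Let T_mul x y : l (x * y)%g = (l x + l y)%N -> T x * T y = T (x * y)%g.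
Proof. by case: heckeH => _ _; apply. Qed.

Lemma T_one : T 1%g = 1.
Proof.
have T1_mul x : T 1%g * T x = T x.
  by rewrite T_mul ?mul1g // (len1 coxeterWS).
have [c [[_ one_eq] _]] := basisT 1.
(* In [T 1 * 1] the second factor is expanded in the basis, on whose elements [T 1] acts
   trivially. *)
rewrite -[LHS]mulr1 [X in _ * X]one_eq [RHS]one_eq.
rewrite mulr_sumr; apply: eq_bigr => i _.
by rewrite -scalerAr T1_mul.
Qed.

(** * The normalised basis and the filtration by degree *)

Definition tT w := vinv ^+ l w *: T w.

Lemma tT_one : tT 1%g = 1.
Proof. by rewrite /tT (len1 coxeterWS) expr0 scale1r T_one. Qed.

Lemma tT_mul x y : l (x * y)%g = (l x + l y)%N -> tT x * tT y = tT (x * y)%g.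
Proof.
move=> lxy; rewrite /tT -scalerAl -scalerAr scalerA -exprD T_mul //.
by rewrite -lxy.
Qed.

Definition xi : laurent := v_ - vinv.

Lemma degle_xi : degle 1 xi.
Proof.
by apply: degleD; [exact: degle_v|apply/degleN/degleW/degle_vinv].
Qed.

Lemma tT_sq s : S s -> tT s * tT s = xi *: tT s + 1.
Proof.
move=> Ss; have [_ /(_ s Ss) + _] := heckeH; rewrite /tT (len_simple coxeterWS Ss).
rewrite expr1 mulrDr mulr1 mulrBl -scalerAl mul1r => /eqP.
rewrite addr_eq0 subr_eq opprB => /eqP sq.
rewrite -scalerAl -scalerAr scalerA.
have -> : T s * T s = (q_ - 1) *: T s + q_ *: 1.
  by rewrite sq scalerBl scale1r addrC [_ - T s]addrC addrA.
have v2 : vinv * v_ = 1 by rewrite mulrC mul_v_vinv.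
rewrite -scalerA scalerDr !scalerA scalerDr !scalerA; congr (_ *: _ + _).
  rewrite mulrA /xi /q_ expr2 mulrBr mulr1 mulrBl; congr (_ - _).
  by rewrite mulrACA v2 mulr1 mul_v_vinv.
by rewrite mulrA /q_ expr2 mulrACA !v2 mulr1 scale1r.
Qed.

Lemma tT_mul_desc x s : S s -> rdesc S x s ->
  tT x * tT s = xi *: tT x + tT (x * s)%g.
Proof.
move=> Ss xs; have x_eq : tT x = tT (x * s)%g * tT s.
  rewrite tT_mul (simpleK coxeterWS _ Ss) //.
  by rewrite (rdesc_len coxeterWS Ss xs) (len_simple coxeterWS Ss) addn1.
by rewrite x_eq -mulrA tT_sq // mulrDr mulr1 -scalerAr.
Qed.

Lemma tT_mul_asc x s : S s -> ~~ rdesc S x s -> tT x * tT s = tT (x * s)%g.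
Proof.
move=> Ss xs; apply: tT_mul.
by rewrite (rdescN coxeterWS Ss xs) (len_simple coxeterWS Ss) addn1.
Qed.

(* spanle d is v^d times the Z[v^(-1)]-span of the tT w. *)
Inductive spanle d : H -> Prop :=
| spanle_zero : spanle d 0
| spanle_add a w h : degle d a -> spanle d h -> spanle d (a *: tT w + h).

Lemma spanleZT d a w : degle d a -> spanle d (a *: tT w).
Proof.
by move=> da; rewrite -[_ *: _]addr0; apply: spanle_add => //; exact: spanle_zero.
Qed.

Lemma spanleT w : spanle 0 (tT w).
Proof. by rewrite -[tT w]scale1r; apply/spanleZT/degle1. Qed.

Lemma spanleD d h1 h2 : spanle d h1 -> spanle d h2 -> spanle d (h1 + h2).
Proof.
move=> + h2d; elim=> [|a w h da _ IHh]; first by rewrite add0r.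
by rewrite -addrA; exact: spanle_add.
Qed.

Lemma spanleZ d e a h : degle d a -> spanle e h -> spanle (d + e) (a *: h).
Proof.
move=> da; elim=> [|b w h' eb _ IHh]; first by rewrite scaler0; exact: spanle_zero.
by rewrite scalerDr scalerA; apply: spanle_add => //; exact: degleM.
Qed.

Lemma spanleW d e h : d <= e -> spanle d h -> spanle e h.
Proof.
move=> de; elim=> [|a w h' da _ IHh]; first exact: spanle_zero.
by apply: spanle_add => //; apply: degleW da.
Qed.

Lemma spanle_sum (I : eqType) (r : seq I) (Q : pred I) d (F : I -> H) :
  (forall i, i \in r -> Q i -> spanle d (F i)) ->
  spanle d (\sum_(i <- r | Q i) F i).
Proof.
move=> Fd; rewrite big_seq_cond; apply: big_ind => [||i /andP[]].
- exact: spanle_zero.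
- by move=> ? ?; exact: spanleD.
- exact: Fd.
Qed.

Lemma spanleM N d e h1 h2 : (forall w u, spanle N (tT w * tT u)) ->
  spanle d h1 -> spanle e h2 -> spanle (d + e + N) (h1 * h2).
Proof.
move=> TN + h2e; elim=> [|a w h da _ IHh]; first by rewrite mul0r; exact: spanle_zero.
rewrite mulrDl; apply: spanleD => //; elim: h2e {IHh} => [|b u h' eb _ IHh].
  by rewrite mulr0; exact: spanle_zero.
rewrite mulrDr; apply: spanleD => //; rewrite -scalerAl -scalerAr scalerA.
by apply: spanleZ => //; exact: degleM.
Qed.

Section DihedralExpansion.
Variables (J : bool -> W) (m : nat) (c : W).
Hypothesis SJ : forall b, S (J b).
Hypothesis bm : braid J m.
Hypothesis c_min : rmin S J c.

(* After f of the i letters, tT z occurs with degree at most f - m + l(z) - l(c):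
   going up adds 2 to this number, going down adds 0, and staying at z adds 1,
   which pays for the factor xi. *)
Lemma dihedral_expansion (D : int) (Z : H) (i : nat) :
    (forall z, coset J c z -> (m + l c <= i + l z)%N ->
      spanle (D - (i%:Z + (l z)%:Z - (l c)%:Z - m%:Z)) (tT z * Z)) ->
  forall n b f z, (n <= m)%N -> (f + n = i)%N -> coset J c z ->
    (m + l c <= f + l z)%N ->
    spanle (D - (f%:Z + (l z)%:Z - (l c)%:Z - m%:Z)) (tT z * (tT (alt J b n) * Z)).
Proof.
move=> Hi; elim=> [|n IHn] b f z nm fn zJ zf.
  by rewrite tT_one mul1r; move: fn zf; rewrite addn0 => ->; exact: Hi.
have l_alt (b' : bool) k : (k <= m)%N -> l (alt J b' k) = k.
  by move=> km; rewrite alt_ralt (len_ralt_braid coxeterWS SJ bm).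
have -> : tT (alt J b n.+1) = tT (J b) * tT (alt J (~~ b) n).
  rewrite tT_mul -?altS // (l_alt _ _ nm) (l_alt _ _ (ltnW nm)).
  by rewrite (len_simple coxeterWS).
have fn1 : (f.+1 + n = i)%N by lia.
rewrite -mulrA !(mulrA (tT z)); have [zb|zb] := boolP (rdesc S z (J b)).
  have lz := rdesc_len coxeterWS (SJ b) zb.
  rewrite tT_mul_desc // mulrDl -scalerAl; apply: spanleD; last first.
    apply: spanleW (IHn (~~ b) f.+1 _ (ltnW nm) fn1 (cosetMJ coxeterWS SJ b zJ) _).
      by rewrite lz; lia.
    by move: zf; rewrite lz; lia.
  apply: spanleW (spanleZ degle_xi (IHn (~~ b) f.+1 z (ltnW nm) fn1 zJ _)); lia.
have lz := rdescN coxeterWS (SJ b) zb.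
rewrite tT_mul_asc //.
apply: spanleW (IHn (~~ b) f.+1 _ (ltnW nm) fn1 (cosetMJ coxeterWS SJ b zJ) _).
  by rewrite lz; lia.
by rewrite lz; lia.
Qed.

End DihedralExpansion.

(** The first [m - k] letters of the alternating factor complete [ralt J b k] to the longest
    element. The other [k + n - m] letters are treated by [dihedral_expansion], started with [f = 0]
    at the longest element of the coset, where the quantity subtracted from [D] is 0. *)
Lemma braid_expansion J m c u' b k n D :
    (forall b, S (J b)) -> braid J m -> rmin S J c -> lmin S J u' ->
    (k <= m)%N -> (n < m)%N -> (m < k + n)%N ->
    (forall z, coset J c z -> (m + l c <= k + n - m + l z)%N ->
      spanle (D - ((k + n - m)%N%:Z + (l z)%:Z - (l c)%:Z - m%:Z))
        (tT z * tT u')) ->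
  spanle D (tT (c * ralt J b k)%g * tT (alt J (~~ b) n * u')%g).
Proof.
move=> SJ bm c_min u'_min km nm mkn Hz; have [_ _ Jm] := bm.
have Jle i : (i <= m)%N -> distinct_powers J i.
  by move=> im; apply: distinct_powersW Jm.
have l_alt (b' : bool) i : (i <= m)%N -> l (alt J b' i) = i.
  by move=> im; rewrite alt_ralt (len_ralt_braid coxeterWS SJ bm).
pose i := (k + n - m)%N.
have n_eq : n = (m - k + i)%N by rewrite /i; lia.
have mk_m : (m - k <= m)%N := leq_subr _ _.
have im : (i <= m)%N by rewrite /i; lia.
have -> : tT (alt J (~~ b) n * u')%g =
    tT (alt J (~~ b) (m - k)) * (tT (alt J (odd (m - k) (+) ~~ b) i) * tT u').
  have lu' (d : bool) j : (j <= m)%N -> l (alt J d j * u')%g = (j + l u')%N.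
    by move=> jm; rewrite (len_lmin coxeterWS SJ) //; exact: Jle.
  rewrite tT_mul; last by rewrite lu' // l_alt.
  rewrite tT_mul mulgA -(altD coxeterWS SJ) -n_eq //.
  rewrite !lu' ?l_alt //; last exact: ltnW.
  by rewrite [in LHS]n_eq addnA.
rewrite mulrA.
have x_eq : (c * ralt J b k * alt J (~~ b) (m - k))%g = (c * ralt J true m)%g.
  rewrite -mulgA -(braid_alt_ralt coxeterWS SJ (odd k (+) ~~ b) true bm).
  rewrite -[m in RHS](subnKC km) (altD coxeterWS SJ) addbA addbb addFb.
  congr (_ * (_ * _))%g; rewrite alt_ralt; congr ralt.
  by case: (odd k); case: b.
rewrite tT_mul x_eq; last first.
  rewrite !(len_rmin coxeterWS SJ) // ?l_alt //; last exact: Jle.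
  by rewrite -addnA subnKC.
have := @dihedral_expansion J m c SJ bm D (tT u') i Hz i
  (odd (m - k) (+) ~~ b) 0%N (c * ralt J true m)%g im erefl (coset_ralt J c true m).
rewrite (len_rmin coxeterWS SJ) // => /(_ _).
rewrite (_ : D - _ = D); last by lia.
by apply; lia.
Qed.

Lemma distinct_powers2 J : (forall b, S (J b)) -> J true <> J false ->
  distinct_powers J 2.
Proof.
move=> SJ J_neq [|[|k]] // _; rewrite /= mulg1 => /mulg1_eq.
by rewrite (simpleV coxeterWS (SJ true)).
Qed.

Lemma spanle_reduced x u : l (x * u)%g = (l x + l u)%N -> spanle 0 (tT x * tT u).
Proof. by move=> xu; rewrite tT_mul //; exact: spanleT. Qed.

(** By [not_reduced_coset], only a tail of length exactly 2 can give a product that is not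
    reduced. *)
Lemma spanle_coset3 J c b n u d : (forall b, S (J b)) -> J true <> J false ->
    rmin S J c -> lmin S J u -> distinct_powers J n -> (2 < n)%N -> 0 <= d ->
  spanle d (tT (c * ralt J b n)%g * tT u).
Proof.
move=> SJ J_neq c_min u_min Jn n_gt2 d_ge0.
apply: (spanleW d_ge0); apply: spanle_reduced; apply: contrapT.
case: n n_gt2 Jn => [|[|[|n]]] // _ Jn.
move=> xu.
by have [] := not_reduced_coset coxeterWS noncommuting SJ J_neq c_min u_min Jn xu.
Qed.

(** If the product is not reduced, one letter remains to be expanded after the longest element is
    reached, so the new tails have length [m] or [m - 1]. They are longer than 2 unless [m = 3]; a
    tail of length 2 is handled by induction with the same degree 1. *)
Lemma spanle_coset2 J c b u : (forall b, S (J b)) -> J true <> J false ->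
    rmin S J c -> lmin S J u ->
  spanle 1 (tT (c * ralt J b 2)%g * tT u).
Proof.
have [n] := ubnP (l c + l u); elim: n => // n IHn in J c b u *.
rewrite ltnS => lcu SJ J_neq c_min u_min.
have J2 := distinct_powers2 SJ J_neq.
have [/spanle_reduced|xu] := pselect
    (l (c * ralt J b 2 * u) = l (c * ralt J b 2)%g + l u)%N.
  exact: spanleW.
have [_ [J' [b' [m [c' [u' [[SJ' J'b J'_neq] [bm c'_min u'_min] x_eq u_eq lu]]]]]]] :=
  not_reduced_coset coxeterWS noncommuting SJ J_neq c_min u_min J2 xu.
have m_gt2 := braid_ge3 coxeterWS noncommuting SJ' J'_neq bm.
have cc' : l c = l c'.
  have := congr1 l x_eq; rewrite !(len_rmin coxeterWS) //; last exact: distinct_powers2.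
  exact: addIn.
rewrite x_eq u_eq.
apply: (@braid_expansion J' m c' u' b' 2 m.-1) => //; [lia|lia|lia|].
move=> z /(coset_decomposition coxeterWS SJ' c'_min)[e [j [-> Jj ->]]] jm.
have jm' := braid_distinct bm Jj.
have [j_gt2|j_le2] := ltnP 2 j; first by apply: spanle_coset3 => //; lia.
have {}j_le2 : j = 2%N by lia.
rewrite j_le2; apply: spanleW (IHn J' c' e u' _ SJ' J'_neq c'_min u'_min); lia.
Qed.

(** * The degree bound for products of normalised basis elements *)

Section Bound.
Variable N : nat.
Hypothesis N_gt0 : forall s, S s -> (0 < N)%N.
Hypothesis N_braid : forall J m, (forall b, S (J b)) -> J true <> J false ->
  braid J m -> (m <= N)%N.

Lemma spanle_not_common s x u : S s -> rdesc S x s -> ~~ ldesc S u s ->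
  spanle (N%:Z - 1) (tT x * tT u).
Proof.
have [n] := ubnP (l x + l u); elim: n => // n IHn in s x u *.
rewrite ltnS => lxu Ss xs us; have N1 := N_gt0 Ss.
have [/spanle_reduced|xu] := pselect (l (x * u)%g = l x + l u)%N.
  by apply: spanleW; lia.
have [J [b [m [k [i [c [u' [[SJ Jb J_neq] [bm c_min u'_min]
  [x_eq lx u_eq lu] [km im mki]]]]]]]]] :=
  not_reduced coxeterWS noncommuting Ss xs us xu.
have mN := N_braid SJ J_neq bm.
have m_gt2 := braid_ge3 coxeterWS noncommuting SJ J_neq bm.
rewrite x_eq u_eq; apply: (@braid_expansion J m c u' b k i) => //.
move=> z /(coset_decomposition coxeterWS SJ c_min)[e [j [-> Jj lz]]]; rewrite lz => jm.
have jm' := braid_distinct bm Jj.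
(* Tail length 0 would need [2 * m <= k + i]. Length 1 leaves degree [N - 1] for the induction
   hypothesis at the letter [J e]. Length 2 leaves at least [N - 2], hence at least 1, and longer
   tails at least [N - m]. *)
case: j jm jm' Jj lz => [|[|[|j]]] jm jm' Jj lz.
- lia.
- apply: spanleW (IHn (J e) _ u' _ (SJ e) _ (u'_min e)); [lia|lia|].
  exact: (rdesc_ralt coxeterWS SJ).
- by apply: spanleW (spanle_coset2 e SJ J_neq c_min u'_min); lia.
- by apply: spanle_coset3 => //; lia.
Qed.

(** Induction on [l u], splitting off a first letter [s]. The factor [xi], of degree 1, multiplies a
    product to which [spanle_not_common] applies, since [s] is not a left descent of [s * u]. *)
Lemma spanle_product x u : spanle N (tT x * tT u).
Proof.
have [n] := ubnP (l u); elim: n => // n IHn in x u *.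
rewrite ltnS => lu; have [->|u1] := pselect (u = 1%g).
  by rewrite tT_one mulr1; apply: spanleW (spanleT x).
have [s Ss us] : exists2 s, S s & ldesc S u s.
  have [|s Ss us] := @rdesc_exists _ _ coxeterWS u^-1%g.
    by move=> /(congr1 (@monoid.inv W)); rewrite invgK invg1.
  by exists s => //; rewrite (ldescV coxeterWS).
have lsu := ldesc_len coxeterWS Ss us.
have -> : tT u = tT s * tT (s * u)%g.
  rewrite tT_mul (simpleKl coxeterWS _ Ss) //.
  by rewrite lsu (len_simple coxeterWS Ss).
have IH y : spanle N (tT y * tT (s * u)%g) by apply: IHn; rewrite -lsu.
rewrite mulrA; have [xs|xs] := boolP (rdesc S x s); last by rewrite tT_mul_asc.
rewrite tT_mul_desc // mulrDl -scalerAl; apply: spanleD => //.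
apply: spanleW (spanleZ degle_xi (@spanle_not_common s x (s * u)%g Ss xs _)).
  by lia.
by rewrite /ldesc (simpleKl coxeterWS _ Ss) lsu ltnNge leqnSn.
Qed.

End Bound.

Lemma spanle_decomposition d h : spanle d h -> exists c : W -> laurent,
  decomposition T h c /\ forall w, degle (d - (l w)%:Z) (c w).
Proof.
elim=> [|a w h' da _ [c [hc cd]]].
  by exists (fun=> 0); split=> [|w]; [exact: decomposition0|exact: degle0].
exists (fun i => a * vinv ^+ l w * (i == w)%:R + c i); split.
  apply: decompositionD => //; rewrite scalerA.
  by apply: decompositionZ; exact: decomposition1.
move=> i; apply: degleD => //; have [->|_] := eqVneq i w.
  by rewrite mulr1; apply: degleM => //; exact: degle_vinvX.
by rewrite mulr0; exact: degle0.
Qed.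

Lemma spanle_coefficient d h (c : W -> laurent) : spanle d h -> decomposition T h c ->
  forall w, degle (d - (l w)%:Z) (c w).
Proof.
move=> /spanle_decomposition[c' [hc' c'd]] hc w.
have [c0 [_ c0_uniq]] := basisT h.
by rewrite -(c0_uniq _ hc) (c0_uniq _ hc').
Qed.

(** * The Kazhdan-Lusztig basis and the a-function *)

Section KazhdanLusztig.
Variable P : W -> W -> {poly int}.
Hypothesis P_diag : forall w, P w w = 1.
Hypothesis P_size : forall y w, bruhat S y w -> y <> w ->
  (2 * (size (P y w)).-1 + l y + 1 <= l w)%N.
Local Notation C := (KL_element S T P).

Lemma KL_element_tT w : spanle (-1) (C w - tT w).
Proof.
have fin_w := finite_bruhat coxeterWS w.
rewrite /KL_element fsbig_finite //= (big_fsetD1 w) /=; last first.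
  by rewrite in_fset_set //; apply/mem_set; exact: rt_refl.
rewrite P_diag eval_at1 scale1r scalerDr [X in X - _]addrC addrK scaler_sumr.
apply: spanle_sum => y; rewrite in_fsetD1 in_fset_set //.
move=> /andP[/eqP yw /set_mem y_le] _.
have -> : vinv ^+ l w *: (eval_at (P y w) q_ *: T y) =
    (vinv ^+ l w * eval_at (P y w) q_ * v_ ^+ l y) *: tT y.
  by rewrite -!scalerA /tT [v_ ^+ _ *: _]scalerA -exprMn mul_v_vinv expr1n scale1r.
apply: spanleZT.
(* The exponents add up to [- l w + 2 deg P + l y], which the Kazhdan-Lusztig degree bound makes at
   most -1. *)
apply: degleW (degleM (degleM (degle_vinvX _) (degle_q _)) (degle_vX _)).
by have := P_size y_le yw; move: (size _).-1 => k; lia.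
Qed.

Lemma spanle_KL w : spanle 0 (C w).
Proof.
rewrite -[C w](subrK (tT w)); apply: spanleD (spanleT w).
by apply: spanleW (KL_element_tT w).
Qed.

Lemma KL_element1 : C 1%g = 1.
Proof.
rewrite /KL_element (len1 coxeterWS) expr0 scale1r.
have -> : [set y | bruhat S y 1%g] = [set 1%g].
  apply/seteqP; split=> [y y_le|_ ->]; last exact: rt_refl.
  have [||q] := bruhat_subword coxeterWS y_le (p := [::]); rewrite ?big_nil //.
  by rewrite subseq0 => /eqP-> ->; rewrite big_nil.
by rewrite fsbig_set1 P_diag eval_at1 scale1r T_one.
Qed.

(** Replacing each [C w] by [tT w] changes [h] by terms of degree at most [(d + 1) - 1], so the
    [c w] are also the [tT]-coefficients of an element of [spanle d]. *)
Lemma KL_coefficient_step d h (c : W -> laurent) : spanle d h -> decomposition C h c ->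
  (forall w, degle (d + 1) (c w)) -> forall w, degle d (c w).
Proof.
move=> hd /decomposition_fset[r c_r h_eq] cd w.
have sum_d : spanle d (\sum_(w <- r) c w *: tT w).
  have -> : \sum_(w <- r) c w *: tT w = h - \sum_(w <- r) c w *: (C w - tT w).
    rewrite h_eq -sumrB; apply: eq_bigr => y _.
    by rewrite scalerBr opprB addrC subrK.
  apply: spanleD => //; rewrite -scaleN1r -[d]add0r; apply: (spanleZ degleN1).
  apply: spanle_sum => y _ _; rewrite -[d](addrK 1).
  exact: spanleZ (cd y) (KL_element_tT y).
have dec : decomposition T (\sum_(w <- r) c w *: tT w) (fun w => c w * vinv ^+ l w).
  apply/decomposition_fset; exists r => [y /c_r->|]; first by rewrite mul0r.
  by apply: eq_bigr => y _; rewrite scalerA.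
have := degleM (spanle_coefficient sum_d dec w) (degle_vX (l w)).
by rewrite subrK -mulrA -exprMn [vinv * _]mulrC mul_v_vinv expr1n mulr1.
Qed.

(** The finitely many nonzero coefficients have some common degree bound, which is lowered to [d]
    one unit at a time. *)
Lemma KL_coefficient d h (c : W -> laurent) : spanle d h -> decomposition C h c ->
  forall w, degle d (c w).
Proof.
move=> hd hc; have [e ce] : exists e, forall w, degle e (c w).
  have /decomposition_fset[r c_r _] := hc.
  have [e ce] : exists e, forall w, w \in (r : seq W) -> degle e (c w).
    elim: (r : seq W) => [|w s [e IHs]]; first by exists 0.
    have [f cf] := degle_exists (c w); exists (Num.max e f) => y.
    rewrite inE => /predU1P[->|/IHs].
      by apply: degleW cf; rewrite le_max lexx orbT.
    by apply: degleW; rewrite le_max lexx.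
  exists e => w; have [/ce//|/c_r->] := boolP (w \in (r : seq W)).
  exact: degle0.
have [k] : exists k : nat, e <= d + k%:Z by exists `|e - d|%N; lia.
elim: k e ce => [|k IHk] e ce ek w; first by apply: degleW (ce w); lia.
have : forall w, degle (d + k%:Z) (c w).
  apply: KL_coefficient_step hc _ => [|y]; first by apply: spanleW hd; lia.
  by apply: degleW (ce y); lia.
by move=> /IHk; apply.
Qed.

Lemma KL_coordinate_degree d h v : spanle d h -> degle d (coordinate C h v).
Proof.
move=> hd; rewrite /coordinate.
(* When [h] has no decomposition, the coordinate is 0 by default, and 0 has every degree. *)
case: xgetP => [a _ [c hc <-]|_]; last exact: degle0.
exact: KL_coefficient hc v.
Qed.

(** Two decompositions of [C v] differ by a decomposition of 0. As 0 lies in [spanle d] for every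
    [d], the coefficients of the latter have arbitrarily low degree and vanish. *)
Lemma KL_coordinate_diag v : coordinate C (C v) v = 1.
Proof.
apply: xget_unique => [|_ [c vc <-]].
  by exists (fun j => (j == v)%:R); rewrite ?eqxx //; exact: decomposition1.
have dec : decomposition C 0 (fun w => c w + -1 * (w == v)%:R).
  have -> : 0 = C v + -1 *: C v by rewrite scaleN1r subrr.
  by apply: decompositionD => //; apply: decompositionZ; exact: decomposition1.
apply/subr0_eq/degle_eq0 => d; have := KL_coefficient (spanle_zero d) dec v.
by rewrite eqxx mulr1.
Qed.

End KazhdanLusztig.

End Hecke.

(* The constant maps J give [braid J 1], which covers the case of no finite m(s,t). *)
Lemma maximal_braid (W : groupType) (S : set W) (s : W) (N : nat) :
    coxeter_system S -> S s ->
    (forall Q : set W, parabolic S Q -> finite_set Q -> (Q #<= `I_N)%card) ->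
  exists J m, [/\ forall b, S (J b), braid J m &
    forall J' m', (forall b, S (J' b)) -> braid J' m' -> (m' <= m)%N].
Proof.
move=> coxeterWS Ss boundN.
pose Q m := `[< exists J, (forall b, S (J b)) /\ braid J m >].
have exQ : exists m, Q m.
  exists 1%N; apply/asboolP; exists (fun=> s); split=> //; split=> //.
    by rewrite /= mulg1 (simple_sq coxeterWS Ss).
  by move=> [|[|k]].
have bQ m : Q m -> (m <= N)%N.
  move=> /asboolP[J [SJ bm]]; rewrite -card_le_II.
  apply: card_le_trans (card_dih_ge coxeterWS SJ bm) _.
  apply: boundN; first exact: (parabolic_dih coxeterWS).
  exact: (finite_dih coxeterWS SJ bm).
case: (ex_maxnP exQ bQ) => m /asboolP[J [SJ bm]] m_max.
by exists J, m; split=> // J' m' SJ' bm'; apply: m_max; apply/asboolP; exists J'.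
Qed.

(** The [C w] lie in [spanle 0], so their products lie in [spanle N] and the degrees are at most
    [N]. The maximum is taken over a nonempty set because [C 1 * C v = C v] contributes degree 0. *)
Lemma lusztig_a_function_exists (W : groupType) (S : set W)
    (H : algType laurent) (T : W -> H) (P : W -> W -> {poly int}) (N : nat) :
    coxeter_system S -> hecke_algebra S T -> KL_polynomials S T P ->
    (forall x u, spanle S T N (tT S T x * tT S T u)%R) ->
  exists a : W -> nat, lusztig_a_function S T P a /\ forall w, (a w <= N)%N.
Proof.
move=> coxeterWS heckeH [P_diag P_size _] TN.
pose Q v i := exists w u, has_degree (KL_structure_constant S T P w u v) i%:Z.
have Q_le v i : Q v i -> (i <= N)%N.
  move=> [w [u /has_degree_le deg]]; rewrite -lez_nat; apply: deg.
  apply: (KL_coordinate_degree coxeterWS heckeH P_diag P_size).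
  have := spanleM TN (spanle_KL T coxeterWS P_diag P_size w)
    (spanle_KL T coxeterWS P_diag P_size u).
  by rewrite !add0r.
have Q0 v : Q v 0%N.
  exists 1%g, v; rewrite /KL_structure_constant.
  rewrite (KL_element1 coxeterWS heckeH P_diag) mul1r.
  rewrite (KL_coordinate_diag coxeterWS heckeH P_diag P_size).
  exact: has_degree1.
have /choice[a aP] v : exists i, is_max [set i | Q v i] i.
  have exQ : exists i, `[< Q v i >] by exists 0%N; apply/asboolP.
  have bQ i : `[< Q v i >] -> (i <= N)%N by move=> /asboolP/Q_le.
  case: (ex_maxnP exQ bQ) => i /asboolP Qi i_max.
  by exists i; split=> // j Qj; apply: i_max; apply/asboolP.
by exists a; split=> // w; apply: (Q_le w); have [] := aP w.
Qed.

Theorem theorem2p1 (W : groupType) (S : set W)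
    (H : algType laurent) (T : W -> H) (P : W -> W -> {poly int})
    (coxeterWS : coxeter_system S)
    (heckeH : hecke_algebra S T)
    (klP : KL_polynomials S T P)
    (noncommuting : forall s t : W, S s -> S t -> s <> t ->
       (s * t)%g <> (t * s)%g)
    (bounded_parabolics : exists N : nat, forall Q : set W,
       parabolic S Q -> finite_set Q -> (Q #<= `I_N)%card) :
  exists a : W -> nat, lusztig_a_function S T P a /\
    exists (Q : set W) (w0 : W),
      [/\ parabolic S Q, finite_set Q, longest_element S Q w0 &
          forall w : W, (a w <= len S w0)%N].
Proof.
have [N boundN] := bounded_parabolics.
have [[s Ss]|S0] := pselect (exists s, S s).
  have [J [m [SJ bm m_max]]] := maximal_braid coxeterWS Ss boundN.
  have m_gt0 t : S t -> (0 < m)%N by case: bm.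
  have m_braid J' m' (SJ' : forall b, S (J' b)) (_ : J' true <> J' false) :=
    m_max J' m' SJ'.
  have [a [aP a_le]] := lusztig_a_function_exists coxeterWS heckeH klP
    (spanle_product coxeterWS noncommuting heckeH m_gt0 m_braid).
  (* The maximal order [m] is both the degree bound and the length of the longest element of
     [dih J]; for a constant [J] this subgroup has order 2. *)
  exists a; split=> //; exists (dih J), (ralt J true m); split.
  - exact: (parabolic_dih coxeterWS).
  - exact: (finite_dih coxeterWS SJ bm).
  - exact: (longest_dih coxeterWS SJ bm).
  - by rewrite (len_ralt_braid coxeterWS SJ bm).
(* Without generators [W] is trivial, and the trivial parabolic subgroup with bound 0 serves. *)
have W1 (w : W) : w = 1%g.
  elim/(word_ind coxeterWS): w => // s w Ss.
  by case: S0; exists s.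
have T0 x u : spanle S T 0%N (tT S T x * tT S T u)%R.
  rewrite (W1 x) (W1 u); apply: (spanle_reduced heckeH).
  by rewrite mulg1 (len1 coxeterWS).
have [a [aP a_le]] := lusztig_a_function_exists coxeterWS heckeH klP T0.
exists a; split=> //; exists (generated set0), 1%g; split.
- by exists set0.
- by apply: (@sub_finite_set _ _ [set 1%g]) => // x _; rewrite (W1 x).
- split=> [M [M_sub _]|x _]; last by rewrite (W1 x).
  by have [+ _] := M_sub; rewrite inE.
- by move=> w; rewrite (len1 coxeterWS).
Qed.
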